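(* Let $p\ge 3$ and let $k\geq 2$ be an integer. If $k\not\equiv 1\pmod p$, then $V_{E_k}^\#(D(p-1))=V(p_k)$, where $D(p-1)=\bigwedge^{p-1}D^{(kp-1,1)}$ is regarded as an $\mathbb{F}E_k$-module by restriction and $V(p_k)\subseteq\mathbb{A}^k(\mathbb{F})$ is the zero set of $p_k=\sum_{i=1}^{k}(x_1\cdots\widehat{x_i}\cdots x_k)^{p-1}$.
   Context: $\mathbb{F}$ is an algebraically closed field of positive characteristic $p$. In $p_k\in\mathbb{F}[x_1,\dots,x_k]$ the hat means the factor $x_i$ is omitted. $E_k=\langle g_1,\dots,g_k\rangle\le\mathfrak{S}_{kp}$, where $g_i$ is the $p$-cycle $((i-1)p+1,(i-1)p+2,\dots,ip)$; it is elementary abelian of rank $k$. $D(1)=D^{(kp-1,1)}$ is the natural simple $\mathbb{F}\mathfrak{S}_{kp}$-module: the quotient of the subspace of coordinate-sum-zero vectors in the permutation module $\mathbb{F}^{kp}$ by the trivial submodule spanned by the all-ones vector. $D(r)=\bigwedge^rD(1)$ is its $r$th exterior power. (One has $D(p-1)\cong D^{(kp-p+1,1^{p-1})}$, the simple module labelled by this $p$-regular partition.) Rank variety: with $X_i=g_i-1$ and, for $0\ne\alpha\in\mathbb{A}^k(\mathbb{F})$, $u_\alpha=1+\sum_i\alpha_iX_i$ (a unit of order $p$ in $\mathbb{F}E_k$), for an $\mathbb{F}E_k$-module $M$ set $V^\#_{E_k}(M)=\{0\}\cup\{0\neq\alpha\in\mathbb{A}^k(\mathbb{F}): M{\downarrow_{\langle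 u_\alpha\rangle}}\text{ is not a free }\mathbb{F}\langle u_\alpha\rangle\text{-module}\}$. *)

(* Defs.v *)
From HB Require Import structures.
From mathcomp Require Import all_boot all_order all_algebra.
From mathcomp Require Import all_fingroup all_solvable all_field all_character.
From mathcomp Require Import mpoly.

Set Implicit Arguments.
Unset Strict Implicit.
Unset Printing Implicit Defensive.

Import GroupScope GRing.Theory.
Local Open Scope ring_scope.

Section ExteriorPower.

(* Vectors are rows.  The basis of the r-th exterior power of F^n is          *)
(* e_I = e_(I 0) /\ ... /\ e_(I (r-1)), for strictly increasing I.            *)

Variables (F : fieldType) (r n : nat).

Definition strictly_increasing (f : {ffun 'I_r -> 'I_n}) : bool :=
  [forall i : 'I_r, forall j : 'I_r, (i < j)%N ==> (f i < f j)%N].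

Definition ext_index := {f : {ffun 'I_r -> 'I_n} | strictly_increasing f}.

Definition ext_dim := #|{: ext_index}|.

Definition ext_fun (I : 'I_ext_dim) : 'I_r -> 'I_n := val (enum_val I).

(* The coordinates of v_1 /\ ... /\ v_r, where v_i is the i-th row of A; that *)
(* this is the exterior power is wedge_alternating, ext_universal and         *)
(* ext_unique below.                                                          *)
Definition wedge (A : 'M[F]_(r, n)) : 'rV[F]_ext_dim :=
  \row_J \det (colsub (ext_fun J) A).

(* e_I |-> e_(I 0) A /\ ... /\ e_(I (r-1)) A *)
Definition ext_mx (A : 'M[F]_n) : 'M[F]_ext_dim :=
  \matrix_I wedge (rowsub (ext_fun I) A).

Definition set_row (i : 'I_r) (v : 'rV[F]_n) (A : 'M[F]_(r, n)) :=
  \matrix_j (if j == i then v else row j A).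

Definition alternating (W : lmodType F) (phi : 'M[F]_(r, n) -> W) : Prop :=
  (forall i A, linear (fun v => phi (set_row i v A))) /\
  (forall A i j, i != j -> row i A = row j A -> phi A = 0).

Lemma set_row_eq i v A : row i (set_row i v A) = v.
Proof. by rewrite rowK eqxx. Qed.

Lemma set_row_neq i j v A : j != i -> row j (set_row i v A) = row j A.
Proof. by move=> /negPf nji; rewrite rowK nji. Qed.

Lemma set_row_id i A : set_row i (row i A) A = A.
Proof. by apply/row_matrixP=> j; rewrite rowK; case: eqP => [->|]. Qed.

Lemma ext_fun_mono I (i j : 'I_r) : (i < j)%N -> (ext_fun I i < ext_fun I j)%N.
Proof.
by move=> ij; have /forallP/(_ i)/forallP/(_ j)/implyP/(_ ij) := valP (enum_val I).
Qed.

Lemma ext_fun_inj I : injective (ext_fun I).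
Proof.
move=> i j eqij; apply/val_inj; case: (ltngtP i j) => // /(ext_fun_mono I);
by rewrite eqij ltnn.
Qed.

Lemma increasing_perm (f : 'I_r -> 'I_n) :
  injective f -> exists I (s : 'S_r), f =1 ext_fun I \o s.
Proof.
move=> injf; pose S := f @: 'I_r.
have cS : #|S| = r by rewrite card_imset ?card_ord.
have Sf i : f i \in S by rewrite imset_f.
pose J := [ffun i : 'I_r => enum_val (cast_ord (esym cS) i)].
have sorS : sorted (relpre val ltn) (enum S).
  rewrite {1}/enum_mem -enumT sorted_filter => [||].
  - by [].
  - by move=> ? ? ?; apply: ltn_trans.
  - by rewrite -sorted_map val_enum_ord iota_ltn_sorted.
have incJ : strictly_increasing J.
  apply/forallP=> i; apply/forallP=> j; apply/implyP=> ij; rewrite !ffunE.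
  have x0 := f i; rewrite !(enum_val_nth x0).
  apply: (sorted_ltn_nth _ _ sorS) => //=; first by move=> ? ? ?; apply: ltn_trans.
    by rewrite inE -cardE cS.
  by rewrite inE -cardE cS.
pose t i := cast_ord cS (enum_rank_in (Sf i) (f i)).
have tE i : J (t i) = f i by rewrite ffunE cast_ordK enum_rankK_in.
have injt : injective t by move=> i j eqt; apply: injf; rewrite -!tE eqt.
exists (enum_rank (exist _ J incJ : ext_index)), (perm injt) => i.
by rewrite /= permE /ext_fun enum_rankK /= tE.
Qed.

Lemma wedge_basis I : wedge (rowsub (ext_fun I) 1%:M) = delta_mx 0 I.
Proof.
apply/rowP=> J; rewrite !mxE eqxx /=; case: (eqVneq J I) => [->|nJI].
  rewrite -[RHS](det1 F r); congr (\det _); apply/matrixP=> i j.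
  by rewrite !mxE (inj_eq (@ext_fun_inj I)).
rewrite /determinant big1 // => s _; apply/eqP; rewrite mulf_eq0 signr_eq0 /=.
apply: contraR nJI => /prodf_neq0 nz.
have eIJ i : ext_fun I i = ext_fun J (s i).
  have := nz i isT; rewrite !mxE; case: (eqVneq (ext_fun I i)) => // _.
  by rewrite eqxx.
have smono (i j : 'I_r) : (i < j)%N -> (s i < s j)%N.
  move=> /(ext_fun_mono I); rewrite !eIJ => lt; rewrite ltnNge; apply/negP.
  rewrite leq_eqVlt => /orP[/eqP/val_inj eij|/(ext_fun_mono J)].
    by rewrite eij ltnn in lt.
  by rewrite ltnNge (ltnW lt).
have le_s (m : nat) (i : 'I_r) : m = i -> (m <= s i)%N.
  elim: m i => [|m IH] i mi //; have ltmr : (m < r)%N by rewrite ltnW // mi.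
  have ltmi : (Ordinal ltmr < i)%N by rewrite -mi.
  exact: leq_ltn_trans (IH (Ordinal ltmr) erefl) (smono _ _ ltmi).
have s_le m (i : 'I_r) : (i + m.+1 = r)%N -> (s i + m < r)%N.
  elim: m i => [|m IH] i mi; first by rewrite addn0.
  have lti : (i.+1 < r)%N by apply: leq_trans (eq_leq mi); rewrite !addnS !ltnS leq_addr.
  have := IH (Ordinal lti); rewrite /= addSnnS mi => /(_ erefl).
  by apply: leq_trans; rewrite addnS ltnS ltn_add2r smono.
have sid i : s i = i.
  apply/val_inj/eqP; rewrite eqn_leq (le_s i i) // andbT.
  have := @s_le (r - i.+1)%N i; rewrite addnS -addSn subnKC // => /(_ erefl).
  by rewrite -[X in (_ < X)%N -> _](subnKC (ltn_ord i)) ltn_add2r ltnS.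
apply/eqP/enum_val_inj/val_inj/ffunP=> i.
by have := eIJ i; rewrite sid => /esym.
Qed.

Section Alternating.

Variables (W : lmodType F) (phi : 'M[F]_(r, n) -> W).
Hypothesis altphi : alternating phi.

Lemma alt_linear i A : linear (fun v => phi (set_row i v A)).
Proof. by case: altphi. Qed.

Lemma altD i A u v :
  phi (set_row i (u + v) A) = phi (set_row i u A) + phi (set_row i v A).
Proof. by have := alt_linear i A 1 u v; rewrite !scale1r. Qed.

Lemma alt0 A i j : i != j -> row i A = row j A -> phi A = 0.
Proof. by case: altphi => _; apply. Qed.

Lemma alt_set0 i A : phi (set_row i 0 A) = 0.
Proof. by apply: (@addrI _ (phi (set_row i 0 A))); rewrite -altD !addr0. Qed.

Lemma altZ i A a v : phi (set_row i (a *: v) A) = a *: phi (set_row i v A).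
Proof. by have := alt_linear i A a v 0; rewrite addr0 alt_set0 addr0. Qed.

Lemma alt_expand i A :
  phi A = \sum_j A i j *: phi (set_row i (delta_mx 0 j) A).
Proof.
rewrite -{1}(set_row_id i A) {1}(row_sum_delta (row i A)).
rewrite (big_morph (fun v => phi (set_row i v A)) (altD i A) (alt_set0 i A)).
by apply: eq_bigr => j _; rewrite altZ mxE.
Qed.

Lemma alt_xrow i j A : i != j -> phi (xrow i j A) = - phi A.
Proof.
move=> nij; have nji : j != i by rewrite eq_sym.
pose B u v := set_row i u (set_row j v A).
have Bswap u v : B u v = set_row j v (set_row i u A).
  apply/row_matrixP=> l; rewrite !rowK; case: (eqVneq l i) => [->|//].
  by rewrite (negPf nij).
have B0 u : phi (B u u) = 0.
  by apply: (@alt0 _ i j) => //; rewrite set_row_eq Bswap set_row_eq.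
have := B0 (row i A + row j A).
rewrite {1}/B altD -!/(B _ _) !Bswap !altD -!Bswap !B0 add0r addr0.
have -> : B (row i A) (row j A) = A by rewrite /B set_row_id set_row_id.
have -> : B (row j A) (row i A) = xrow i j A.
  apply/row_matrixP=> l; rewrite !rowK; apply/rowP=> m.
  case: (eqVneq l i) => [->|nli]; first by rewrite !mxE tpermL.
  case: (eqVneq l j) => [->|nlj]; first by rewrite !mxE tpermR.
  by rewrite !mxE tpermD // eq_sym.
by move/eqP; rewrite addrC addr_eq0 => /eqP.
Qed.

Lemma alt_row_perm (s : 'S_r) A : phi (row_perm s A) = (-1) ^+ s *: phi A.
Proof.
have [ts -> _] := prod_tpermP s; elim: ts A => [|[i j] ts IH] A.
  by rewrite big_nil row_perm1 odd_perm1 scale1r.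
rewrite big_cons row_permM /= -/(xrow i j _) odd_permM odd_tperm.
case: (eqVneq i j) => [<-|nij] /=.
  by rewrite /xrow tperm1 row_perm1 IH.
by rewrite alt_xrow // IH signrN scaleNr ?scalerN.
Qed.

Lemma alt_eq0 :
  (forall I, phi (rowsub (ext_fun I) 1%:M) = 0) -> forall A, phi A = 0.
Proof.
move=> phi0; pose basis m (A : 'M[F]_(r, n)) :=
  forall i : 'I_r, (m <= i)%N -> exists j, row i A = delta_mx 0 j.
suffices phiB m : (m <= r)%N -> forall A, basis m A -> phi A = 0.
  by move=> A; apply: (phiB r) => // i; rewrite leqNgt ltn_ord.
elim: m => [|m IH] lemr A basA; last first.
  rewrite (alt_expand (Ordinal lemr)) big1 // => j _.
  rewrite IH ?scaler0 ?(ltnW lemr) // => i lemi.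
  case: (eqVneq i (Ordinal lemr)) => [->|nim].
    by exists j; rewrite set_row_eq.
  rewrite set_row_neq //; apply: basA; rewrite ltn_neqAle lemi andbT.
  by rewrite eq_sym; apply: contra nim => /eqP eim; apply/eqP/val_inj.
have [f fA] := fin_all_exists (fun i => basA i (leq0n i)).
have {fA basA} -> : A = rowsub f 1%:M.
  by apply/row_matrixP=> i; rewrite fA row_rowsub row1.
have [/injectiveP injf|/injectivePn[i [j nij fij]]] := boolP (injectiveb f).
  have [I [s fE]] := increasing_perm injf.
  have -> : rowsub f 1%:M = row_perm s (rowsub (ext_fun I) 1%:M) :> 'M[F]_(r, n).
    by apply/matrixP=> i j; rewrite !mxE fE.
  by rewrite alt_row_perm phi0 scaler0.
by apply: (alt0 nij); rewrite !row_rowsub fij.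
Qed.

End Alternating.


Lemma det_alternating (J : 'I_ext_dim) :
  alternating (fun A => \det (colsub (ext_fun J) A) : F^o).
Proof.
split=> [i A a u v|A i j nij eqij].
  rewrite (@determinant_multilinear _ _ _
     (colsub (ext_fun J) (set_row i u A))
     (colsub (ext_fun J) (set_row i v A)) i a 1) ?mul1r //.
  - by apply/rowP=> j; rewrite !mxE eqxx !mxE mul1r.
  - by apply/matrixP=> j l; rewrite !mxE eq_sym (negPf (neq_lift _ _)).
  - by apply/matrixP=> j l; rewrite !mxE eq_sym (negPf (neq_lift _ _)).
apply: (determinant_alternate nij) => l; rewrite !mxE.
by move/rowP/(_ (ext_fun J l)): eqij; rewrite !mxE.
Qed.

Lemma wedge_alternating : alternating wedge.
Proof.
split=> [i A a u v|A i j nij eqij]; apply/rowP=> J; rewrite !mxE.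
  by have [-> _] := det_alternating J.
by have [_ /(_ _ _ _ nij eqij)] := det_alternating J.
Qed.

Lemma ext_universal (W : lmodType F) (phi : 'M[F]_(r, n) -> W) A :
  alternating phi ->
  phi A = \sum_I wedge A 0 I *: phi (rowsub (ext_fun I) 1%:M).
Proof.
move=> altphi; apply/eqP; rewrite -subr_eq0; apply/eqP; move: A.
apply: alt_eq0 => [|I].
  have [wl w0] := wedge_alternating.
  split=> [i A a u v|A i j nij eqij]; last first.
    rewrite (w0 _ _ _ nij eqij) (alt0 altphi nij eqij) sub0r big1 ?oppr0 // => I _.
    by rewrite mxE scale0r.
  rewrite (alt_linear altphi) wl scalerBr -addrACA -opprD; congr (_ - _).
  rewrite scaler_sumr -big_split; apply: eq_bigr => I _ /=.
  by rewrite !mxE scalerDl scalerA.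
rewrite wedge_basis (bigD1 I) //= big1 ?addr0 => [|J nJI].
  by rewrite mxE !eqxx scale1r subrr.
by rewrite mxE (negPf nJI) andbF scale0r.
Qed.

Lemma ext_unique (W : lmodType F) (f g : {linear 'rV[F]_ext_dim -> W}) :
  (forall A, f (wedge A) = g (wedge A)) -> f =1 g.
Proof.
move=> eqfg v; rewrite (row_sum_delta v) !linear_sum; apply: eq_bigr => I _ /=.
by rewrite !linearZ /= -wedge_basis eqfg.
Qed.

Lemma wedge_mul A B : wedge (A *m B) = wedge A *m ext_mx B.
Proof.
have altB : alternating (fun A => wedge (A *m B)).
  have mul_set i v C : set_row i v C *m B = set_row i (v *m B) (C *m B).
    by apply/row_matrixP=> j; rewrite row_mul !rowK row_mul; case: eqP.
  have [wl w0] := wedge_alternating.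
  split=> [i C a u v|C i j nij eqij].
    by rewrite !mul_set mulmxDl -scalemxAl wl.
  by apply: (w0 _ _ _ nij); rewrite !row_mul eqij.
rewrite (ext_universal _ altB) mulmx_sum_row; apply: eq_bigr => I _.
by rewrite rowK mul_rowsub_mx mul1mx.
Qed.

Lemma ext_mx1 : ext_mx 1%:M = 1%:M.
Proof. by apply/row_matrixP=> I; rewrite rowK wedge_basis row1. Qed.

Lemma ext_mxM A B : ext_mx (A *m B) = ext_mx A *m ext_mx B.
Proof.
by apply/row_matrixP=> I; rewrite row_mul !rowK -wedge_mul mul_rowsub_mx.
Qed.

Section ExtRepr.

Variables (gT : finGroupType) (G : {group gT}) (rG : mx_representation F G n).

Lemma ext_mx_repr : mx_repr G (fun x => ext_mx (rG x)).
Proof.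
by split=> [|x y Gx Gy]; rewrite ?repr_mx1 ?ext_mx1 // repr_mxM // ext_mxM.
Qed.

Definition ext_repr := MxRepresentation ext_mx_repr.

End ExtRepr.

End ExteriorPower.

Section NaturalModule.

Variables (F : fieldType) (n : nat).

Lemma perm_mx_repr : mx_repr [set: 'S_n] (@perm_mx F n).
Proof. by split=> [|s t _ _]; rewrite (perm_mx1, perm_mxM). Qed.

Definition perm_repr : mx_representation F [set: 'S_n] n :=
  MxRepresentation perm_mx_repr.

(* Submodules are row spaces. *)
Definition sum_zero : 'M[F]_n := kermx (const_mx 1 : 'cV_n).

Definition all_ones : 'M[F]_n := <<const_mx 1 : 'rV_n>>%MS.

Lemma sum_zeroP (v : 'rV[F]_n) :
  reflect (\sum_i v 0 i = 0) (v <= sum_zero)%MS.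
Proof.
have vE : (v *m (const_mx 1 : 'cV_n)) 0 0 = \sum_i v 0 i.
  by rewrite mxE; apply: eq_bigr => i _; rewrite mxE mulr1.
apply: (iffP sub_kermxP) => [v0|s0]; first by rewrite -vE v0 mxE.
by apply/matrixP=> i j; rewrite !ord1 vE s0 mxE.
Qed.

Lemma sum_zero_module : mxmodule perm_repr sum_zero.
Proof.
apply/mxmoduleP=> s _; apply/sub_kermxP; rewrite -mulmxA.
suff -> : perm_repr s *m const_mx 1 = const_mx 1 :> 'cV_n by apply: mulmx_ker.
by rewrite /= -row_permE; apply/matrixP=> i j; rewrite !mxE.
Qed.

Lemma all_ones_module : mxmodule perm_repr all_ones.
Proof.
rewrite (eqmx_module _ (genmxE _)); apply/mxmoduleP=> s _.
suff -> : const_mx 1 *m perm_repr s = const_mx 1 :> 'rV_n by [].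
by rewrite /= -[s]invgK -col_permE; apply/matrixP=> i j; rewrite !mxE.
Qed.

(* The image of sum_zero in F^n / all_ones, i.e. sum_zero / all_ones whenever *)
(* n = 0 in F.                                                                *)
Definition natural_simple_repr :=
  section_repr all_ones_module sum_zero_module.

Definition D_repr (r : nat) := ext_repr r natural_simple_repr.

End NaturalModule.

Section ElementaryAbelian.

Variables (k p : nat).

(* Points and blocks are numbered from 0; see block_val. *)
Definition block (i : 'I_k) : seq 'I_(k * p) :=
  [seq j : 'I_(k * p) <- enum 'I_(k * p) | (i * p <= j < i.+1 * p)%N].

Lemma block_val i : map val (block i) = iota (i * p)%N p.
Proof.
have e : (k * p = i * p + (p + (k - i.+1) * p))%N.
  by rewrite addnA -mulSnr -mulnDl subnKC.
pose P := (fun j : nat => i * p <= j < i.+1 * p)%N.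
have -> : map val (block i) = filter P (iota 0 (k * p)%N).
  by rewrite /block -val_enum_ord filter_map.
have lo : filter P (iota 0 (i * p)%N) = [::].
  rewrite (@eq_in_filter _ _ pred0) ?filter_pred0 // => x.
  by rewrite mem_iota add0n /P => /andP[_ h]; rewrite leqNgt h.
have mid : filter P (iota (i * p)%N p) = iota (i * p)%N p.
  by apply/all_filterP/allP => x; rewrite mem_iota /P mulSnr.
have hi m : filter P (iota (i * p + p)%N m) = [::].
  rewrite (@eq_in_filter _ _ pred0) ?filter_pred0 // => x.
  rewrite mem_iota /P mulSnr => /andP[h _].
  by rewrite [(x < _)%N]ltnNge h andbF.
by rewrite [X in iota 0 X]e !iotaD !filter_cat add0n lo mid hi cats0.
Qed.

Lemma block_uniq i : uniq (block i).
Proof. by rewrite filter_uniq ?enum_uniq. Qed.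

Definition Egen (i : 'I_k) : 'S_(k * p) :=
  perm (can_inj (prev_next (block_uniq i))).

Lemma EgenE i j : Egen i j = next (block i) j.
Proof. by rewrite /Egen permE. Qed.

Definition Egroup : {group 'S_(k * p)} := <<[set Egen i | i : 'I_k]>>%G.

End ElementaryAbelian.

Section RankVariety.

Variables (F : fieldType) (gT : finGroupType) (E : {group gT}) (k p : nat).
Variable g : 'I_k -> gT.

(* The element u_alpha of the group algebra FE, which acts on a module M      *)
(* through gring_op.                                                          *)
Definition shifted_unit (alpha : {ffun 'I_k -> F}) : 'M[F]_(gcard E) :=
  1%:M + \sum_i alpha i *: (regular_repr F E (g i) - 1%:M).

(* M has a basis (b_j) over F<u>, where u has order p, so that the elements   *)
(* of F<u> are the \sum_(i < p) c_i u^i for unique c_i.                       *)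
Definition free_over_cyclic (u : 'M[F]_(gcard E)) n
    (rM : mx_representation F E n) : Prop :=
  exists m (b : 'I_m -> 'rV[F]_n), forall v : 'rV[F]_n,
  exists! c : 'M[F]_(m, p),
    v = \sum_j b j *m gring_op rM (\sum_(i < p) c j i *: u ^+ i).

Definition rank_variety n (rM : mx_representation F E n)
    (alpha : {ffun 'I_k -> F}) : Prop :=
  alpha = 0 \/ alpha != 0 /\ ~ free_over_cyclic (shifted_unit alpha) rM.

End RankVariety.

Definition p_poly (F : fieldType) (k p : nat) : {mpoly F[k]} :=
  \sum_(i < k) (\prod_(j < k | j != i) 'X_j) ^+ p.-1.

Definition zero_set (F : fieldType) (k : nat) (f : {mpoly F[k]})
    (alpha : {ffun 'I_k -> F}) : Prop :=
  f.@[alpha] = 0.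

(* Main.v *)
(* An element of order p acts freely through u = 1 + t if and only if         *)
(* ker t = im t^(p-1).  Here t = \sum_i alpha_i (wedge^(p-1) g_i - 1), with   *)
(* the g_i = 1 + X_i acting on V = D(1).  By Newton's identities t differs    *)
(* from the derivation d(T) of wedge^(p-1) V induced by                       *)
(* T = \sum_i alpha_i log(1 + X_i) only by products y z of commuting          *)
(* nilpotent operators, and such products do not affect freeness.             *)
(*                                                                            *)
(* If T has k-1 Jordan blocks of size p, then dim V = kp - 2 leaves only p-2  *)
(* dimensions beside the free part.  There are h and a projection pi onto the *)
(* free part with (ad T)^(p-1) h = pi, whence (ad d(T))^(p-1) (d h) = d(pi);  *)
(* the eigenvalues of d(pi) on wedge^(p-1) V lie in {1, ..., p-1}, so that    *)
(* d(pi) is invertible and ker d(T) = im d(T)^(p-1).  Otherwise V has, with   *)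
(* respect to T, a direct summand of dimension p-1 with trivial determinant,  *)
(* whose top exterior power is a trivial summand of wedge^(p-1) V.            *)
(*                                                                            *)
(* On the sum-zero vectors, T^(p-1) is \sum_i alpha_i^(p-1) eps_i sigma_i,    *)
(* with eps_i the coordinate sum over the i-th block and sigma_i its          *)
(* indicator; it has rank k-1 modulo the all-ones vector if and only if the   *)
(* quadratic form \sum_i alpha_i^(p-1) x_i^2 is nondegenerate on              *)
(* \sum_i x_i = 0, and the Gram determinant of that form is p_k(alpha).       *)

Require Import Defs.
From HB Require Import structures.
From mathcomp Require Import all_boot all_order all_algebra.
From mathcomp Require Import all_fingroup all_solvable all_field all_character.
From mathcomp Require Import mpoly.

Import GRing.Theory.
Local Open Scope ring_scope.

Set Implicit Arguments.
Unset Strict Implicit.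
Unset Printing Implicit Defensive.

(** * Freeness over a truncated polynomial algebra *)

(** Write [u_alpha = 1 + t] for the action on the exterior power. Freeness over the cyclic group
    amounts to ker t lying in im t^(p-1) ([free_exactP]), a property that is insensitive to adding
    products of commuting p-nilpotent operators to t ([p_exact_add_sum]).

    The coefficients of [ext_mx (1 + s X)] in s are elementary symmetric functions of the actions of
    X on the p-1 factors, and the power sums are derivations. Newton's identities involve only
    denominators below p, so they give [ext_mx (1 + X)] = 1 + the derivation of log(1 + X) +
    products of the above kind ([ext_mx_log]). Hence t may be replaced by the derivation
    [ext_der Td], where [Td] is the sum of the alpha_i log(1 + X_i) on D(1) ([p_exact_ext_log]).

    What remains is linear algebra of [Td], controlled by the form with diagonal entries
    alpha_i^(p-1) on the sum-zero vectors of F^k. If [gram_poly] is nonzero, the form is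
    nondegenerate ([diag_form_sum0]) and provides k-1 Jordan blocks of size p. Fewer than p-1
    dimensions are left over, and a commutator argument yields exactness ([ext_der_free_exact]). If
    [gram_poly] vanishes, there are p-1 vectors and p-1 functionals, stable under [Td] with trace
    zero and paired nondegenerately; their wedges contradict exactness ([ext_der_not_exact]). The
    two cases meet in [exact_gram_polyP], proved for an abstract model of D(1); the p-cycles and the
    section module supply its hypotheses. *)

Section CharPRing.

Variables (R : pzRingType) (p : nat).
Hypotheses (p_pr : prime p) (pR0 : p%:R = 0 :> R).

Lemma natr_dvd m : (p %| m)%N -> m%:R = 0 :> R.
Proof. by case/dvdnP=> q ->; rewrite natrM pR0 mulr0. Qed.

(** Pascal's rule: C(p, i+1) vanishes mod p, so consecutive C(p-1, i) are negatives of each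
    other. *)
Lemma sign_bin_pred i : (i < p)%N -> (-1) ^+ i *+ 'C(p.-1, i) = 1 :> R.
Proof.
elim: i => [|i IH] ltip; first by rewrite bin0 expr0.
have [p' ep] : exists p', p = p'.+1 by exists p.-1; rewrite prednK ?prime_gt0.
have := prime_dvd_bin p_pr (ltip : (0 < i.+1 < p)%N).
move=> /natr_dvd; rewrite {1}ep binS natrD ep /= -/(p'.+1).
move/eqP; rewrite addr_eq0 => /eqP h; rewrite -mulr_natr h.
have := IH (ltnW ltip); rewrite ep /= => {3}<-.
by rewrite exprS mulN1r mulrNN mulr_natr.
Qed.

Lemma exprD_char (x y : R) : GRing.comm x y -> (x + y) ^+ p = x ^+ p + y ^+ p.
Proof.
move=> cxy; rewrite exprDn_comm // big_ord_recr /= subnn expr0 mul1r binn.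
have [p' ep] : exists p', p = p'.+1 by exists p.-1; rewrite prednK ?prime_gt0.
move: p_pr natr_dvd; rewrite ep => pr' dv.
rewrite big_ord_recl /= subn0 expr0 mulr1 bin0 !mulr1n big1 ?addr0 // => i _.
rewrite -mulr_natr dv ?mulr0 // prime_dvd_bin //= /bump /= add1n ltnS.
exact: ltn_ord.
Qed.

Lemma exprB_pred (x y : R) : GRing.comm x y ->
  (x - y) ^+ p.-1 = \sum_(i < p) x ^+ (p.-1 - i) * y ^+ i.
Proof.
move=> cxy; rewrite exprBn_comm // prednK ?prime_gt0 //.
apply: eq_bigr => i _; rewrite -!mulrA -mulrnAl.
by rewrite sign_bin_pred // mul1r.
Qed.

Lemma exprB_pred_recl (x y : R) : GRing.comm x y ->
  (x - y) ^+ p.-1 =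
    x ^+ p.-1 + y * \sum_(i < p.-1) x ^+ (p.-1.-1 - i) * y ^+ i.
Proof.
move=> cxy; rewrite exprB_pred //.
rewrite -(big_mkord xpredT (fun i => x ^+ (p.-1 - i) * y ^+ i)).
rewrite -{1}(prednK (prime_gt0 p_pr)) big_nat_recl // big_mkord.
rewrite subn0 expr0 mulr1 mulr_sumr; congr (_ + _); apply: eq_bigr => i _.
rewrite exprS !mulrA -(commrX _ (commr_sym cxy)).
by rewrite -[p.-2]subn1 -subnDA add1n.
Qed.

Lemma exprM0_char (y z : R) : GRing.comm y z -> y ^+ p = 0 -> (y * z) ^+ p = 0.
Proof. by move=> cyz y0; rewrite exprMn_comm // y0 mul0r. Qed.

End CharPRing.

Section Exact.

Variables (F : fieldType) (p : nat).
Hypothesis (pcharF : p \in [pchar F]).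

Let p_pr : prime p := pcharf_prime pcharF.

Lemma mx_pchar0 N : p%:R = 0 :> 'M[F]_N.
Proof.
by rewrite -[1]/(1%:M : 'M[F]_N) -scaler_nat pcharf0 // scale0r.
Qed.

(** When t^p = 0 the opposite inclusion is automatic, and the condition says that every Jordan block
    of t has size p. *)
Definition p_exact N (t : 'M[F]_N) : Prop :=
  forall v : 'rV_N, v *m t = 0 -> exists w, v = w *m t ^+ p.-1.

(** Dimension count: dim ker t^(p-1) = N - rank t^(p-1) is at most N - dim ker t = rank t, so the
    inclusion of im t in ker t^(p-1) is an equality. *)
Lemma p_exact_pred N (t : 'M[F]_N) : t ^+ p = 0 -> p_exact t ->
  forall v : 'rV_N, v *m t ^+ p.-1 = 0 -> exists w, v = w *m t.
Proof.
move=> tp0 ext v vt0; apply/submxP.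
have sub : (t <= kermx (t ^+ p.-1))%MS.
  by apply/sub_kermxP; rewrite mulmxE -exprS prednK ?prime_gt0.
apply: submx_trans (_ : (kermx (t ^+ p.-1) <= t)%MS); first exact/sub_kermxP.
have [_ <-] := mxrank_leqif_sup sub; rewrite eqn_leq mxrankS //=.
rewrite mxrank_ker leq_subLR addnC -leq_subLR -mxrank_ker mxrankS //.
apply/row_subP=> i; apply/submxP.
by apply: ext; rewrite -row_mul mulmx_ker row0.
Qed.

(* With t = x + yz and K = \sum_(j < p-1) t^(p-2-j) (yz)^j, one has           *)
(* x K = t^(p-1) - (yz)^(p-1) and x^(p-1) = t^(p-1) + yzK.  If v t = 0 and    *)
(* v z = w t^(p-1), then v + w y K is killed by x, which makes it some        *)
(* m x^(p-1); then (m z - w) x^(p-1) = 0, so m z - w = m' x, and it follows   *)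
(* that v = (m + m' y) t^(p-1).                                               *)
Lemma p_exact_add_mul N (x y z : 'M[F]_N) :
    GRing.comm x y -> GRing.comm x z -> GRing.comm y z ->
    x ^+ p = 0 -> y ^+ p = 0 -> (exists e, z ^+ e = 0) ->
  p_exact x -> p_exact (x + y * z).
Proof.
move=> cxy cxz cyz xp0 yp0 [e ze0] exx.
have exx' := p_exact_pred xp0 exx.
set n := y * z; set t := x + n.
have cxn : GRing.comm x n by apply: commrM.
have cnx := commr_sym cxn; have cyx := commr_sym cxy.
have czx := commr_sym cxz; have czy := commr_sym cyz.
have cnt : GRing.comm n t by apply: commrD => //.
have ctn := commr_sym cnt.
have cty : GRing.comm t y.
  by apply/commr_sym/commrD => //; apply: commrM.
have ctz : GRing.comm t z by apply/commr_sym/commrD => //; apply: commrM.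
pose K := \sum_(i < p.-1) t ^+ (p.-1.-1 - i) * n ^+ i.
have xE : x = t - n by rewrite /t addrK.
have xK : x * K = t ^+ p.-1 - n ^+ p.-1 by rewrite subrXX_comm // -xE.
have xp : x ^+ p.-1 = t ^+ p.-1 + n * K.
  by rewrite {1}xE (exprB_pred_recl p_pr (mx_pchar0 N) ctn).
have cK a : GRing.comm a t -> GRing.comm a n -> GRing.comm K a.
  move=> cat can; apply/commr_sym/commr_sum => i _.
  by apply: commrM; apply: commrX.
have cKx : GRing.comm K x by apply: cK => //; rewrite /t; apply: commrD.
have cKy : GRing.comm K y.
  by apply: cK; [apply: commr_sym | apply: commrM].
have cKz : GRing.comm K z.
  by apply: cK; [apply: commr_sym | apply: commrM].
have n0y : n ^+ p.-1 * y = 0.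
  rewrite exprMn_comm // -mulrA -(commrX _ cyz) mulrA -exprSr.
  by rewrite prednK ?prime_gt0 // yp0 mul0r.
have Kyx : K * y * x = t ^+ p.-1 * y.
  by rewrite -mulrA cyx mulrA cKx xK mulrBl n0y subr0.
have Kyz : z * (K * y) = n * K.
  by rewrite mulrA -cKz -mulrA czy -/n cK.
have cnK : GRing.comm K n by apply: cK.
have step (v w : 'rV_N) : v *m t = 0 -> v *m z = w *m t ^+ p.-1 ->
    exists w, v = w *m t ^+ p.-1.
  move=> vt wE.
  have v'x : (v + w *m (K * y)) *m x = 0.
    rewrite mulmxDl -(mulmxA w (K * y) x) [(K * y) *m x]Kyx.
    rewrite mulmxA -wE -mulmxA [z *m y]czy.
    by rewrite -mulmxDr -/n.
  have [m mE] := exx _ v'x.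
  pose q := m *m z - w.
  have vE : v = m *m t ^+ p.-1 + q *m (K * y).
    rewrite mulmxBl addrA -mulmxA [z *m _]Kyz -mulmxDr -xp -mE.
    by rewrite addrK.
  have qx : q *m x ^+ p.-1 = 0.
    rewrite xp mulmxDr {1}/q mulmxBl -wE -mulmxA [z *m _](commrX _ (commr_sym
      ctz)).
    rewrite {1}vE mulmxDl mulmxA.
    have -> : q *m (K * y) *m z = q *m (n * K).
      by rewrite -mulmxA -Kyz (commrM (commr_sym cKz) czy).
    by rewrite opprD addrA subrr sub0r addNr.
  have [m' qE] := exx' _ qx.
  exists (m + m' *m y); rewrite vE qE mulmxDl; congr (_ + _).
  rewrite -!mulmxA; congr (_ *m _).
  rewrite [x *m _](commrM (commr_sym cKx) cxy) Kyx.
  by rewrite [y *m _](commrX _ (commr_sym cty)).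
move=> v vt0.
have: exists e, v *m z ^+ e = 0 by exists e; rewrite ze0 mulmx0.
case=> {ze0}e ze0; elim: e v vt0 ze0 => [|e IH] v vt0 ze0.
  by exists 0; rewrite mul0mx -[v]mulmx1.
have vzt : v *m z *m t = 0.
  by rewrite -mulmxA -[z *m t]ctz mulmxA vt0 mul0mx.
have [|w wE] := IH _ vzt; first by rewrite -mulmxA mulmxE -exprS.
exact: step wE.
Qed.

Lemma p_exact_add_sum N (I : Type) (s : seq I) (x : 'M[F]_N) (y z : I -> 'M_N) :
    (forall i, GRing.comm x (y i)) -> (forall i, GRing.comm x (z i)) ->
    (forall i j, GRing.comm (y i) (y j)) ->
    (forall i j, GRing.comm (y i) (z j)) ->
    (forall i j, GRing.comm (z i) (z j)) ->
    x ^+ p = 0 -> (forall i, y i ^+ p = 0) -> (forall i, z i ^+ p = 0) ->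
  p_exact x <-> p_exact (x + \sum_(i <- s) y i * z i).
Proof.
move=> cxy cxz cyy cyz czz xp0 yp0 zp0.
have dir x' (y' : I -> 'M_N) : (forall i, GRing.comm x' (y' i)) ->
    (forall i, GRing.comm x' (z i)) -> (forall i j, GRing.comm (y' i) (y' j)) ->
    (forall i j, GRing.comm (y' i) (z j)) -> (forall i, y' i ^+ p = 0) ->
    x' ^+ p = 0 -> p_exact x' -> p_exact (x' + \sum_(i <- s) y' i * z i).
  move=> + + cy'y' cy'z y'p0; elim: s x' => [|i s' IH] x' cx'y cx'z x'p0 ex.
    by rewrite big_nil addr0.
  rewrite big_cons addrA; apply: IH => [j|j||].
  - by apply/commr_sym/commrD; [apply/commr_sym | apply: commrM].
  - apply/commr_sym/commrD; first exact/commr_sym.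
    by apply: commrM => //; apply/commr_sym.
  - rewrite (exprD_char p_pr (mx_pchar0 N)); last exact: commrM.
    by rewrite x'p0 (exprM0_char _ (y'p0 i)) ?addr0.
  - by apply: p_exact_add_mul => //; exists p.
split; first exact: dir.
(* The converse is the same perturbation argument with [- y i] in place of [y i]. *)
move=> ex; have -> : x = x + \sum_(i <- s) y i * z i + \sum_(i <- s) (- y i) *
  z i.
  by rewrite -addrA -big_split big1 ?addr0 //= => i _; rewrite mulNr subrr.
have cD w : GRing.comm w x -> (forall i, GRing.comm w (y i)) ->
   (forall i, GRing.comm w (z i)) -> GRing.comm (x + \sum_(i <- s) y i * z i) w.
  move=> cx cy cz; apply/commr_sym/commrD => //; apply: commr_sum => i _.
  exact: commrM.
apply: dir => // [i|i|i j|i j|i|].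
- by apply/commrN/cD => //; exact: commr_sym.
- by apply: cD => [|j|j] //; exact: commr_sym.
- by apply/commrN/commr_sym/commrN.
- by apply/commr_sym/commrN/commr_sym.
- by rewrite exprNn yp0 mulr0.
rewrite (exprD_char p_pr (mx_pchar0 N)); last first.
  by apply: commr_sum => i _; apply: commrM.
rewrite xp0 add0r; elim: s {ex cD} => [|i s' IH].
  by rewrite big_nil expr0n gtn_eqF ?prime_gt0.
rewrite big_cons (exprD_char p_pr (mx_pchar0 N)); last first.
  apply: commr_sum => j _.
  by apply: commrM; apply: commr_sym; apply: commrM => //; apply: commr_sym.
by rewrite IH (exprM0_char _ (yp0 i)) ?addr0.
Qed.

End Exact.

(** * Derivations of exterior powers *)

Section ExteriorDerivation.

Variables (F : fieldType) (r n : nat).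
Implicit Types (A : 'M[F]_(r, n)) (X Y : 'M[F]_n).

Definition mul_row (j : 'I_r) X A := set_row j (row j A *m X) A.

Lemma set_rowC i j u v A : i != j ->
  set_row i u (set_row j v A) = set_row j v (set_row i u A).
Proof.
move=> nij; apply/row_matrixP=> l; rewrite !rowK.
by case: (eqVneq l i) => [->|//]; rewrite (negPf nij).
Qed.

Lemma set_row_set i u v A : set_row i u (set_row i v A) = set_row i u A.
Proof. by apply/row_matrixP=> l; rewrite !rowK; case: eqP. Qed.

Lemma mul_row_set i X u A : mul_row i X (set_row i u A) = set_row i (u *m X) A.
Proof. by rewrite /mul_row set_row_eq set_row_set. Qed.

Lemma mul_row_set_neq i j X u A : i != j ->
  mul_row i X (set_row j u A) = set_row j u (mul_row i X A).
Proof. by move=> nij; rewrite /mul_row set_row_neq // set_rowC. Qed.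

Lemma mul_rowM i X Y A : mul_row i Y (mul_row i X A) = mul_row i (X *m Y) A.
Proof. by rewrite [mul_row i X A]/mul_row mul_row_set -mulmxA. Qed.

Lemma mul_rowC i j X Y A : i != j ->
  mul_row i X (mul_row j Y A) = mul_row j Y (mul_row i X A).
Proof.
move=> nij; rewrite [mul_row j Y A]/mul_row mul_row_set_neq // /mul_row
  set_row_neq //.
by rewrite eq_sym.
Qed.

Definition ext_der X : 'M[F]_(ext_dim r n) :=
  \matrix_I \sum_j wedge (mul_row j X (rowsub (ext_fun I) 1%:M)).

Lemma wedge_ext_der A X : wedge A *m ext_der X = \sum_j wedge (mul_row j X A).
Proof.
have [wl w0] := @wedge_alternating F r n.
have alt : alternating (fun A => \sum_j wedge (mul_row j X A)).
  split=> [i B a u v|B i j nij eqij].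
    rewrite scaler_sumr -big_split; apply: eq_bigr => j _ /=.
    case: (eqVneq j i) => [->|nji].
      by rewrite !mul_row_set mulmxDl -scalemxAl wl.
    by rewrite !mul_row_set_neq // wl.
  (* With rows i and j equal, the terms that hit row i and row j differ by a row swap and cancel;
     the other terms still contain two equal rows. *)
  rewrite (bigD1 i) //= (bigD1 j) 1?eq_sym //= big1 ?addr0 => [|l].
    have -> : mul_row j X B = xrow i j (mul_row i X B).
      apply/row_matrixP=> l; apply/rowP=> m; rewrite /mul_row eqij !mxE.
      case: tpermP => [->|->|/eqP nli /eqP nlj].

      - by rewrite (negPf nij) [j == i]eq_sym (negPf nij) eqij.
      - by rewrite !eqxx.
      - by rewrite (negPf nli) (negPf nlj).
    by rewrite (alt_xrow (@wedge_alternating F r n)) // subrr.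
  by case/andP=> li lj; apply: (w0 _ _ _ nij); rewrite !set_row_neq 1?eq_sym.
rewrite (ext_universal A alt) mulmx_sum_row.
by apply: eq_bigr => I _; rewrite rowK.
Qed.

Lemma wedge_mx_ext (f g : 'M[F]_(ext_dim r n)) :
  (forall A, wedge A *m f = wedge A *m g) -> f = g.
Proof.
by move=> eqfg; apply/row_matrixP=> I; rewrite !rowE -wedge_basis eqfg.
Qed.

Lemma ext_der_linear : linear ext_der.
Proof.
move=> a X Y; apply: wedge_mx_ext => A.
rewrite mulmxDr -scalemxAr !wedge_ext_der scaler_sumr -big_split.
apply: eq_bigr => j _ /=; rewrite /mul_row mulmxDr -scalemxAr.
by have [-> _] := @wedge_alternating F r n.
Qed.

HB.instance Definition _ :=
  GRing.isLinear.Build F 'M[F]_n 'M[F]_(ext_dim r n) *:%R ext_der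
    ext_der_linear.

(** In either product, the terms hitting two different factors form a sum symmetric in X and Y, so
    they cancel; those hitting one factor twice give X Y and Y X. *)
Lemma ext_der_bracket X Y :
  ext_der (X * Y - Y * X) = ext_der X * ext_der Y - ext_der Y * ext_der X.
Proof.
have dM Z Z' A : wedge A *m (ext_der Z * ext_der Z') =
    wedge A *m ext_der (Z * Z') +
    \sum_j \sum_(i | i != j) wedge (mul_row i Z' (mul_row j Z A)).
  rewrite mulmxA !wedge_ext_der mulmx_suml -big_split; apply: eq_bigr => j _.
  by rewrite wedge_ext_der (bigD1 j) //= mul_rowM.
have crossC Z Z' A :
    \sum_j \sum_(i | i != j) wedge (mul_row i Z' (mul_row j Z A)) =
    \sum_j \sum_(i | i != j) wedge (mul_row i Z (mul_row j Z' A)).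
  rewrite (exchange_big_dep predT) //=; apply: eq_bigr => i _.
  rewrite (eq_bigl (fun j => j != i)) => [|j]; last by rewrite eq_sym.
  by apply: eq_bigr => j nji; rewrite mul_rowC 1?eq_sym.
apply: wedge_mx_ext => A; rewrite linearB /= !mulmxBr !dM crossC.
by rewrite opprD addrACA subrr addr0.
Qed.

Lemma ext_der_comm X Y : GRing.comm X Y -> GRing.comm (ext_der X) (ext_der Y).
Proof.
move=> cXY; apply/eqP; rewrite -subr_eq0 -ext_der_bracket cXY subrr.
by rewrite linear0.
Qed.

End ExteriorDerivation.

Lemma closed_poly_eq0 (F : closedFieldType) (P : {poly F}) :
  (forall s, P.[s] = 0) -> P = 0.
Proof.
move=> P0; have : size (P + 1) = 1%N.
  apply/eqP/negPn/negP => /closed_rootP[x /eqP].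
  by rewrite hornerD P0 hornerC add0r => /eqP; rewrite oner_eq0.
move/eqP/size_poly1P => [c c0 E].
have PE : P = (c - 1)%:P by rewrite polyCB -E addrK.
by have := P0 0; rewrite {1}PE hornerC => c1; rewrite PE c1 polyC0.
Qed.

Lemma mx_poly_coef_eq (F : closedFieldType) m n q (v w : nat -> 'M[F]_(m, n)) :
  (forall s : F, \sum_(i < q) s ^+ i *: v i = \sum_(i < q) s ^+ i *: w i) ->
  forall i, (i < q)%N -> v i = w i.
Proof.
move=> eqvw i ltiq; apply/matrixP=> a b.
have : \poly_(j < q) (v j a b - w j a b) = 0.
  apply: closed_poly_eq0 => s; rewrite horner_poly.
  have /matrixP/(_ a b) := eqvw s; rewrite !summxE => /eqP.
  rewrite -subr_eq0 -sumrB => /eqP E; rewrite -[RHS]E; apply: eq_bigr => j _.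
  by rewrite !mxE mulrBl mulrC [w _ _ _ * _]mulrC.
move/polyP/(_ i); rewrite coef_poly ltiq coef0 => /eqP.
by rewrite subr_eq0 => /eqP.
Qed.

(** * Newton's identities for operators on exterior powers *)

Section Newton.

Variables (F : closedFieldType) (r n : nat).
Implicit Types (A : 'M[F]_(r, n)) (X Y : 'M[F]_n) (S : {set 'I_r}).

Definition split_mul S X Y A : 'M[F]_(r, n) :=
  \matrix_j (if j \in S then row j A *m X else row j A *m Y).

Lemma wedge_mulD A X Y :
  wedge (A *m (X + Y)) = \sum_S wedge (split_mul S X Y A).
Proof.
apply/rowP=> J; rewrite summxE mxE /determinant.
under [RHS]eq_bigr do rewrite mxE /determinant.
rewrite exchange_big /=; apply: eq_bigr => s _; rewrite -mulr_sumr;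
  congr (_ * _).
pose G (Z : 'M[F]_n) i : F := (A *m Z) i (ext_fun J (s i)).
rewrite (eq_bigr (fun i => G X i + G Y i)) => [|i _]; last first.
  by rewrite mxE mulmxDr mxE.
rewrite bigA_distr; apply: eq_bigr => S _ /=.
rewrite [RHS](eq_bigr (fun i => if i \in S then G X i else G Y i)) // => i _.
by rewrite !mxE /G; case: ifP => _; rewrite !mxE; apply: eq_bigr => j _;
  rewrite mxE.
Qed.

(* With X_j the action of X on the j-th factor, this is the elementary        *)
(* symmetric polynomial e_m(X_1, ..., X_r), while ext_der (X^l) is the power  *)
(* sum X_1^l + ... + X_r^l.                                                   *)
Definition ext_coef (m : nat) X : 'M[F]_(ext_dim r n) :=
  \matrix_I \sum_(S : {set 'I_r} | #|S| == m) wedge (split_mul S X 1%:M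
    (rowsub (ext_fun I) 1%:M)).

Lemma wedge_mul_series A X s :
  wedge (A *m (1%:M + s *: X)) =
  \sum_(m < r.+1) s ^+ m *: \sum_(S : {set 'I_r} | #|S| == m) wedge (split_mul
    S X 1%:M A).
Proof.
rewrite addrC wedge_mulD (partition_big (fun S : {set 'I_r} =>
  inord #|S| : 'I_r.+1) predT) //=.
apply: eq_bigr => m _; rewrite scaler_sumr.
have cS S : (#|S| < r.+1)%N by rewrite ltnS -[X in (_ <= X)%N](card_ord r)
  max_card.
apply: eq_big => S; first by rewrite -val_eqE /= inordK.
rewrite -val_eqE /= inordK // => /eqP <-.
have -> : split_mul S (s *: X) 1%:M A =
    diag_mx (\row_j (if j \in S then s else 1)) *m split_mul S X 1%:M A.
  apply/matrixP=> i j; rewrite mul_diag_mx !mxE.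
  by case: ifP => _; rewrite -?scalemxAr !mxE ?mul1r.
apply/rowP=> J; rewrite !mxE.
have -> : colsub (ext_fun J) (diag_mx (\row_j (if j \in S then s else 1)) *m
  split_mul S X 1%:M A) = diag_mx (\row_j (if j \in S then s else 1)) *m
  colsub (ext_fun J) (split_mul S X 1%:M A).
  by apply/matrixP=> i j; rewrite !mxE; apply: eq_bigr => l _; rewrite !mxE.
rewrite det_mulmx det_diag; congr (_ * _).
rewrite (bigID (mem S)) /= [X in _ * X]big1 => [|i /negPf nS];
  last by rewrite mxE nS.
by rewrite mulr1 (eq_bigr (fun => s)) ?prodr_const // => i iS; rewrite mxE iS.
Qed.

Lemma ext_mx_series X s :
  ext_mx r (1%:M + s *: X) = \sum_(m < r.+1) s ^+ m *: ext_coef m X.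
Proof.
apply/row_matrixP=> I.
have -> : row I (ext_mx r (1%:M + s *: X)) =
    wedge (rowsub (ext_fun I) 1%:M *m (1%:M + s *: X)).
  by rewrite wedge_mul wedge_basis -rowE.
rewrite wedge_mul_series linear_sum; apply: eq_bigr => m _.
by rewrite linearZ /= rowK.
Qed.

(** [ext_coef] is defined on basis wedges only. Comparing coefficients of s in the multiplicative
    series extends the formula to all wedges. *)
Lemma wedge_ext_coef A X m : (m <= r)%N ->
  wedge A *m ext_coef m X = \sum_(S : {set 'I_r} | #|S| == m) wedge (split_mul
    S X 1%:M A).
Proof.
move=> mr; apply: (mx_poly_coef_eq (q := r.+1) (v := fun m =>
  wedge A *m ext_coef m X)
  (w := fun m => \sum_(S : {set 'I_r} | #|S| == m) wedge (split_mul S X 1%:M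
    A))) => // s.
rewrite -wedge_mul_series wedge_mul ext_mx_series mulmx_sumr.
by apply: eq_bigr => i _; rewrite scalemxAr.
Qed.

Lemma sum_set_del (V : nmodType) (f : {set 'I_r} -> 'I_r -> V) m :
  \sum_(S : {set 'I_r} | #|S| == m.+1) \sum_(j in S) f S j =
  \sum_(S : {set 'I_r} | #|S| == m) \sum_(j | j \notin S) f (j |: S) j.
Proof.
rewrite !pair_big_dep /=.
rewrite (reindex_onto (fun q => (q.2 |: q.1, q.2)) (fun q =>
  (q.1 :\ q.2, q.2))) /=.
  apply: eq_big => [[S j]|[S j] _] //=;
    rewrite setU11 andbT xpair_eqE eqxx andbT.
  apply/andP/andP=> [[cS /eqP eS]|[/eqP cS nj]].
    have nj : j \notin S by rewrite -eS !inE eqxx.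
    by move: cS; rewrite cardsU1 nj add1n eqSS => ->.
  by rewrite cardsU1 nj cS add1n setU1K.
by case=> S j /= /andP[_ jS]; rewrite setD1K.
Qed.

(** The symmetric sum of the products of X_j^l with m distinct X_i, i different from j; it
    interpolates between the two sides of Newton's identity. *)
Definition mixed_sum m l X A : 'rV[F]_(ext_dim r n) :=
  \sum_(S : {set 'I_r} | #|S| == m)
    \sum_(j | j \notin S) wedge (mul_row j (X ^+ l) (split_mul S X 1%:M A)).

Lemma mul_row_split_mul S j X l A : j \notin S ->
  mul_row j (X ^+ l) (split_mul (j |: S) X 1%:M A) =
  mul_row j (X ^+ l.+1) (split_mul S X 1%:M A).
Proof.
move=> jS; apply/row_matrixP=> i; rewrite !rowK !inE eqxx (negPf jS) /=.
by case: (eqVneq i j) => //= _; rewrite -mulmxA mulmxE exprS mulmx1.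
Qed.

(** Expand e_m times the l-th power sum according to whether the index j of the power lies in S. If
    it does, moving j out of S raises its exponent to l+1. *)
Lemma mixed_sum_rec m l X A : (m <= r)%N ->
  wedge A *m (ext_coef m X * ext_der r (X ^+ l)) =
  mixed_sum m l X A + (if m is m'.+1 then mixed_sum m' l.+1 X A else 0).
Proof.
move=> mr; rewrite mulmxA wedge_ext_coef // mulmx_suml.
have split_sum S : wedge (split_mul S X 1%:M A) *m ext_der r (X ^+ l) =
    \sum_(j | j \notin S) wedge (mul_row j (X ^+ l) (split_mul S X 1%:M A)) +
    \sum_(j in S) wedge (mul_row j (X ^+ l) (split_mul S X 1%:M A)).
  by rewrite wedge_ext_der (bigID (mem S)) addrC.
rewrite (eq_bigr _ (fun S _ => split_sum S)).
rewrite big_split /=; congr (_ + _).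
case: m mr => [|m] mr.
  by rewrite big1 // => S; rewrite cards_eq0 => /eqP->;
    rewrite big_pred0 // => j; rewrite inE.
rewrite (sum_set_del (fun S j =>
  wedge (mul_row j (X ^+ l) (split_mul S X 1%:M A)))).
apply: eq_bigr => S _; apply: eq_bigr => j jS.
by rewrite mul_row_split_mul.
Qed.

Lemma mixed_sum1 m X A : (m < r)%N ->
  mixed_sum m 1 X A = wedge A *m (m.+1%:R *: ext_coef m.+1 X).
Proof.
move=> mr; rewrite -scalemxAr wedge_ext_coef //.
pose f S (j : 'I_r) := wedge (split_mul S X 1%:M A).
transitivity (\sum_(S : {set 'I_r} | #|S| == m.+1) \sum_(j in S) f S j).
  rewrite sum_set_del; apply: eq_bigr => S _; apply: eq_bigr => j jS.
  rewrite -mul_row_split_mul // /f expr0; congr wedge; apply/row_matrixP=> i;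
    rewrite !rowK.
  by case: eqP => [->|]; rewrite ?mulmx1.
rewrite scaler_sumr; apply: eq_bigr => S /eqP cS.
by rewrite /f sumr_const cS scaler_nat.
Qed.

Lemma mixed_sumE m l X A : (m <= r)%N ->
  mixed_sum m l X A = wedge A *m
    (\sum_(i < m.+1) (-1) ^+ i *: (ext_coef (m - i) X * ext_der r (X ^+ (l +
      i)))).
Proof.
elim: m l => [|m IH] l mr.
  have := mixed_sum_rec l X A mr; rewrite addr0 => <-.
  by rewrite big_ord_recl big_ord0 addr0 expr0 scale1r addn0.
have /eqP := mixed_sum_rec l X A mr; rewrite -subr_eq => /eqP <-.
rewrite IH ?(ltnW mr) // [in RHS]big_ord_recl expr0 scale1r addn0 subn0
  -mulmxBr.
congr (_ *m (_ + _)); rewrite -sumrN; apply: eq_bigr => i _.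
by rewrite /= /bump leq0n add1n [(-1) ^+ _.+1]exprS mulN1r scaleNr addnS subSS.
Qed.

Lemma newton m X : (m < r)%N ->
  m.+1%:R *: ext_coef m.+1 X =
  \sum_(i < m.+1) (-1) ^+ i *: (ext_coef (m - i) X * ext_der r (X ^+ i.+1)).
Proof.
move=> mr; apply: wedge_mx_ext => A.
by rewrite -mixed_sum1 // mixed_sumE // ltnW.
Qed.

Lemma ext_coef0 X : ext_coef 0 X = 1%:M.
Proof.
have := ext_mx_series X 0; rewrite scale0r addr0 ext_mx1 => ->.
rewrite big_ord_recl expr0 scale1r big1 ?addr0 // => i _.
by rewrite expr0n scale0r.
Qed.

End Newton.

Lemma commrZ (F : fieldType) n (Z A : 'M[F]_n) a :
  GRing.comm Z A -> GRing.comm Z (a *: A).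
Proof.
by move=> cZA; rewrite /GRing.comm -mulmxE -scalemxAr -scalemxAl !mulmxE cZA.
Qed.

Lemma exprZmx (F : fieldType) n (A : 'M[F]_n) a m : (a *: A) ^+ m = a ^+ m *:
  A ^+ m.
Proof.
elim: m => [|m IH]; first by rewrite !expr0 scale1r.
by rewrite !exprS IH -!mulmxE -scalemxAr -scalemxAl scalerA mulrC.
Qed.

Lemma exprsum_char (R : pzRingType) p (I : Type) (s : seq I) (f : I -> R) :
    prime p -> p%:R = 0 :> R -> (forall i j, GRing.comm (f i) (f j)) ->
  (\sum_(i <- s) f i) ^+ p = \sum_(i <- s) f i ^+ p.
Proof.
move=> pp p0 cf; elim: s => [|i s IH].
  by rewrite !big_nil expr0n gtn_eqF ?prime_gt0.
rewrite !big_cons exprD_char ?IH //; exact: commr_sum.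
Qed.

Lemma ext_mxX (F : fieldType) r n (A : 'M[F]_n) m :
  ext_mx r (A ^+ m) = ext_mx r A ^+ m.
Proof. by elim: m => [|m IH]; rewrite ?ext_mx1 // !exprS ext_mxM IH. Qed.

(** * The truncated logarithm and exterior powers in characteristic p *)

Section Logarithm.

Variables (F : closedFieldType) (p r n : nat).
Hypotheses (pcharF : p \in [pchar F]) (ltrp : (r < p)%N).
Implicit Types (X Y : 'M[F]_n).

Let p_pr : prime p := pcharf_prime pcharF.

Lemma natrS_neq0 m : (m < r)%N -> m.+1%:R != 0 :> F.
Proof.
move=> mr; rewrite -(dvdn_pcharf pcharF) gtnNdvd //.
exact: leq_ltn_trans ltrp.
Qed.

Lemma ext_coefS m X : (m < r)%N -> ext_coef r m.+1 X =
  \sum_(i < m.+1) ((-1) ^+ i / m.+1%:R) *: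
    (ext_coef r (m - i) X * ext_der r (X ^+ i.+1)).
Proof.
move=> mr; apply: (scalerI (natrS_neq0 mr)); rewrite newton // scaler_sumr.
apply: eq_bigr => i _; rewrite scalerA mulrCA divff ?mulr1 //.
exact: natrS_neq0.
Qed.

(** Newton's recursion expresses [ext_coef] through the power sums [ext_der (X ^+ l)]. *)
Lemma ext_coef_comm X (Z : 'M[F]_(ext_dim r n)) m :
    (forall l, GRing.comm Z (ext_der r (X ^+ l))) -> (m <= r)%N ->
  GRing.comm Z (ext_coef r m X).
Proof.
move=> cZ; elim/ltn_ind: m => -[|m] IH mr.
  by rewrite ext_coef0; apply: commr1.
rewrite ext_coefS //; apply: commr_sum => i _; apply: commrZ.
apply: commrM => //; apply: IH; first by rewrite ltnS leq_subr.
by rewrite (leq_trans (leq_subr _ _)) // ltnW.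
Qed.

Lemma ext_coef_comm2 X Y m l : GRing.comm X Y -> (m <= r)%N -> (l <= r)%N ->
  GRing.comm (ext_coef r m X) (ext_coef r l Y).
Proof.
move=> cXY mr lr; apply: ext_coef_comm => // j; apply/commr_sym.
apply: ext_coef_comm => // i; apply: ext_der_comm; apply: commrX.
by apply/commr_sym/commrX.
Qed.

(* ext_mx (1 + x X)^p = ext_mx (1 + x^p X^p) = 1 for every scalar x, while the *)
(* left-hand side is \sum_m x^(pm) (ext_coef m X)^p.                          *)
Lemma ext_coef_exp_char X m : X ^+ p = 0 -> (0 < m <= r)%N ->
  ext_coef r m X ^+ p = 0.
Proof.
move=> Xp0 /andP[m_gt0 mr].
pose v i := ext_coef r i X ^+ p.
pose w i : 'M[F]_(ext_dim r n) := if i is 0 then 1%:M else 0.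
have pch k := mx_pchar0 pcharF k.
have p_gt0 := prime_gt0 p_pr.
suffices -> : ext_coef r m X ^+ p = w m by case: (m) m_gt0.
apply: (mx_poly_coef_eq (q := r.+1) (v := v) (w := w)) => // s.
(* A p-th root of s turns the series in x^p into a polynomial identity valid at every scalar s. *)
have [x xE] : exists x, x ^+ p = s.
  have [x xE] := solve_monicpoly (fun i => if i is 0 then s else 0) p_gt0.
  exists x; rewrite xE (bigD1 (Ordinal p_gt0)) //= mulr1 big1 ?addr0 // => i.
  by case: i => -[|i] ? // _; rewrite mul0r.
have := congr1 (fun A => A ^+ p) (ext_mx_series r X x).
have e1 : (1%:M : 'M[F]_n) ^+ p = 1%:M := expr1n _ p.
rewrite -ext_mxX (exprD_char p_pr (pch n)) ?e1 ?exprZmx ?Xp0 ?scaler0 ?addr0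
  //; last first.
  exact/commr_sym/commr1.
rewrite ext_mx1 (exprsum_char _ p_pr (pch _)) => [E|i j]; last first.
  apply: commrZ; apply/commr_sym/commrZ.
  by apply: ext_coef_comm2; [exact: commr_refl | rewrite -ltnS;
    exact: ltn_ord | rewrite -ltnS; exact: ltn_ord].
rewrite [in RHS]big_ord_recl [X in _ = _ + X]big1 => [|i _];
  last by rewrite scaler0.
rewrite addr0 expr0 scale1r [w _]E; apply: eq_bigr => i _.
by rewrite exprZmx -xE -!exprM mulnC.
Qed.

Lemma ext_der_exp_char X : X ^+ p = 0 -> (0 < r)%N -> ext_der r X ^+ p = 0.
Proof.
move=> Xp0 r_gt0; rewrite -[ext_der r X](_ : ext_coef r 1 X = _).
  exact: ext_coef_exp_char.
by rewrite ext_coefS // big_ord1 expr0 divr1 scale1r subn0 ext_coef0 mul1r.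
Qed.

(* The truncated logarithm of 1 + X.                                          *)
Definition log1p_mx X : 'M[F]_n :=
  \sum_(i < r) ((-1) ^+ i / i.+1%:R) *: X ^+ i.+1.

(* Newton's identity expresses ext_coef m as a multiple of ext_der (X^m) plus *)
(* products of positive-degree terms.                                         *)
Lemma ext_mx_log X :
  ext_mx r (1%:M + X) = 1%:M + ext_der r (log1p_mx X) +
    \sum_(q : 'I_r * 'I_r | (q.2 < q.1)%N)
      ext_der r (X ^+ q.2.+1) *
      (((-1) ^+ q.2 / q.1.+1%:R) *: ext_coef r (q.1 - q.2) X).
Proof.
have := ext_mx_series r X 1; rewrite scale1r => ->.
rewrite big_ord_recl expr0 scale1r ext_coef0 -addrA; congr (_ + _).
rewrite linear_sum.
rewrite -(pair_big_dep predT (fun i j : 'I_r => (j < i)%N) (fun i j =>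
  ext_der r (X ^+ j.+1) * (((-1) ^+ j / i.+1%:R) *: ext_coef r (i - j) X))) /=.
rewrite -big_split; apply: eq_bigr => i _ /=.
rewrite expr1n scale1r /bump leq0n add1n ext_coefS // big_ord_recr /= addrC.
rewrite subnn ext_coef0 mul1r linearZ; congr (_ + _).
rewrite -(big_mkord xpredT (fun j =>
  ((-1) ^+ j / i.+1%:R) *: (ext_coef r (i - j) X * ext_der r (X ^+ j.+1)))).
rewrite (big_nat_widen _ _ r) ?(ltnW (ltn_ord i)) // big_mkord.
apply: eq_bigr => j _; rewrite -mulmxE -scalemxAr !mulmxE; congr (_ *: _).
apply: commr_sym; apply: ext_coef_comm => [l|].
  by apply: ext_der_comm; apply: commrX; apply/commr_sym/commrX.
by rewrite (leq_trans (leq_subr _ _)) // ltnW.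
Qed.

End Logarithm.

(** * The free and the non-free case *)

Lemma iter_adjoint (R : pzRingType) (t h : R) q :
  iter q (fun a => a * t - t * a) h =
  \sum_(i < q.+1) (-1) ^+ i * t ^+ i * h * t ^+ (q - i) *+ 'C(q, i).
Proof.
elim: q => [|q IH].
  by rewrite big_ord1 !expr0 bin0 !mul1r mulr1.
rewrite iterS {}IH mulr_suml mulr_sumr.
rewrite [RHS]big_ord_recl bin0 subn0 mulr1n.
under [X in _ = _ + X]eq_bigr => i _ do
  rewrite /= /bump leq0n add1n subSS binS mulrnDr.
rewrite big_split /= addrA -sumrN; congr (_ + _).
  rewrite [X in _ = _ + X]big_ord_recr /= bin_small // mulr0n addr0.
  rewrite big_ord_recl /= bin0 subn0 mulr1n -!mulrA -exprSr; congr (_ + _).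
  apply: eq_bigr => i _; rewrite /bump leq0n add1n mulrnAl -!mulrA -exprSr.
  by rewrite -subSn // subSS.
apply: eq_bigr => i _.
rewrite mulrnAr -mulNrn; congr (_ *+ _).
by rewrite [(-1) ^+ i.+1]exprS mulN1r exprS !mulNr -!(commrX _ (commrN1 _))
  !mulrA.
Qed.

Section FreePart.

Variables (F : closedFieldType) (p r n m : nat).
Hypotheses (pcharF : p \in [pchar F]) (ltrp : (r < p)%N).
Variables (T : 'M[F]_n) (V : 'M[F]_(m, n)) (W : 'M[F]_(n, m)).
Hypotheses (Tp0 : T ^+ p = 0)
  (VTW : forall j, (j < p)%N -> V *m T ^+ j *m W = (j == p.-1)%:R%:M)
  (dim_n : (n < m * p + r)%N).

Let p_pr : prime p := pcharf_prime pcharF.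
Let p_gt0 : (0 < p)%N := prime_gt0 p_pr.

(* In characteristic p this is (ad T)^(p-1) (W V).                            *)
Definition free_proj : 'M[F]_n :=
  \sum_(i < p) T ^+ i * (W *m V) * T ^+ (p.-1 - i).

Lemma nilp_exp j : (p <= j)%N -> T ^+ j = 0.
Proof. by move=> lepj; rewrite -(subnKC lepj) exprD Tp0 mul0r. Qed.

Lemma free_projE j : (j < p)%N -> V *m T ^+ j *m free_proj = V *m T ^+ j.
Proof.
move=> ltjp; rewrite mulmx_sumr.
have ltj' : (p.-1 - j < p)%N by rewrite (leq_ltn_trans (leq_subr _ _)) ?prednK.
have lejp : (j <= p.-1)%N by rewrite -ltnS prednK.
have step i : V *m T ^+ j *m (T ^+ i * (W *m V) * T ^+ (p.-1 - i)) =
   (V *m T ^+ (j + i) *m W) *m (V *m T ^+ (p.-1 - i)).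
  by rewrite exprD -!mulmxE !mulmxA.
rewrite (bigD1 (Ordinal ltj')) //= big1 => [|i ne].
  by rewrite addr0 step VTW subnKC ?prednK // eqxx mul1mx subKn.
rewrite step; have [ltjip|] := ltnP (j + i) p; last first.
  by move=> le; rewrite nilp_exp // mulmx0 !mul0mx.
rewrite VTW // (_ : _ == _ = false); first by rewrite mulr0n raddf0 mul0mx.
apply/negbTE; apply: contra ne => /eqP e; apply/eqP/val_inj => /=.
by rewrite -e addKn.
Qed.

Lemma free_proj_idem : free_proj * free_proj = free_proj.
Proof.
rewrite {1}/free_proj mulr_suml; apply: eq_bigr => i _.
rewrite -!mulmxE -!mulmxA; congr (_ *m (_ *m _)); rewrite mulmxA free_projE //.
by rewrite (leq_ltn_trans (leq_subr _ _)) ?prednK.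
Qed.

(** Both products are the same sum up to a shift of the index by one; the two end terms contain T^p
    = 0. *)
Lemma free_proj_comm : GRing.comm T free_proj.
Proof.
pose f i := T ^+ i * (W *m V) * T ^+ (p - i).
have ETf : T * free_proj = \sum_(i < p) f i.+1.
  rewrite mulr_sumr; apply: eq_bigr => i _; rewrite !mulrA -exprS /f.
  by rewrite -subn1 -subnDA add1n.
have EfT : free_proj * T = \sum_(i < p) f i.
  rewrite mulr_suml; apply: eq_bigr => i _; rewrite -!mulrA -exprSr /f -!mulrA.
  by rewrite -subn1 subnAC subn1 prednK ?subn_gt0.
rewrite /GRing.comm ETf EfT; apply: (addrI (f 0%N)).
have -> : f 0%N + \sum_(i < p) f i.+1 = \sum_(i < p.+1) f i by rewrite
  big_ord_recl.
by rewrite big_ord_recr addrC /= /f subn0 subnn Tp0 mulr0 mul0r mul0r.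
Qed.

(** Each multiplication by T lowers the rank of pi T^q by the dimension of its intersection with ker
    T, which contains the row space of pi T^(p-1), of rank at least m. *)
Lemma free_proj_rank : (m * p <= \rank free_proj)%N.
Proof.
suffices rk i : (i < p)%N -> (m * i.+1 <= \rank (free_proj *m T ^+ (p.-1 -
  i)))%N.
  by have := rk p.-1; rewrite prednK // subnn expr0 mulmx1; apply.
elim: i => [|i IH] ltip.
  rewrite muln1 subn0 -(mxrank1 F m).
  apply: (@leq_trans (\rank (V *m (free_proj *m T ^+ p.-1) *m W))).
    rewrite [free_proj *m _](commrX _ (commr_sym free_proj_comm)) -mulmxE.
    by rewrite mulmxA free_projE ?prednK // VTW ?prednK ?eqxx.
  apply: leq_trans (mxrankM_maxl _ _) (mxrankM_maxr _ _).
have e : (p.-1 - i = (p.-1 - i.+1).+1)%N by rewrite subnS prednK // subn_gt0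
  -ltnS prednK.
set q := (p.-1 - i.+1)%N in e *.
rewrite -(mxrank_mul_ker _ T) mulnS addnC leq_add //.
  by rewrite mulmxE -mulrA -exprSr -e IH // ltnW.
have le1 : (m <= \rank (free_proj *m T ^+ p.-1))%N.
  rewrite -(mxrank1 F m).
  apply: (@leq_trans (\rank (V *m (free_proj *m T ^+ p.-1) *m W))).
    rewrite [free_proj *m _](commrX _ (commr_sym free_proj_comm)) -mulmxE.
    by rewrite mulmxA free_projE ?prednK // VTW ?prednK ?eqxx.
  apply: leq_trans (mxrankM_maxl _ _) (mxrankM_maxr _ _).
apply: leq_trans le1 (mxrankS _); rewrite sub_capmx; apply/andP; split.
  have -> : p.-1 = (i.+1 + q)%N by rewrite subnKC // -ltnS prednK.
  rewrite exprD mulmxE mulrA [free_proj * _](commrX _ (commr_sym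
    free_proj_comm)) -mulrA.
  exact: submxMl.
by apply/sub_kermxP; rewrite mulmxE -mulrA -exprSr prednK // Tp0 mulr0.
Qed.

Lemma free_proj_corank : (\rank (1 - free_proj)%R < r)%N.
Proof.
have : ((1 - free_proj)%R <= kermx free_proj)%MS.
  by apply/sub_kermxP; rewrite mulmxE mulrBl mul1r free_proj_idem subrr.
move/mxrankS; rewrite mxrank_ker => /leq_ltn_trans; apply.
rewrite ltn_subLR ?rank_leq_row //.
by apply: leq_trans dim_n _; rewrite leq_add2r free_proj_rank.
Qed.

Lemma wedge_rank_lt (A : 'M[F]_(r, n)) : (\rank A < r)%N -> wedge A = 0.
Proof.
move=> rkA; apply/rowP=> J; rewrite !mxE; apply/eqP; rewrite -[_ == _]negbK.
apply/negP => nz; have : colsub (ext_fun J) A \in unitmx by rewrite unitmxE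
  unitfE.
rewrite -row_free_unit /row_free => /eqP rk.
move: rkA; rewrite ltnNge -{1}rk; case/negP.
have -> : colsub (ext_fun J) A = A *m colsub (ext_fun J) 1%:M.
  apply/matrixP=> i j; rewrite !mxE (bigD1 (ext_fun J j)) //= big1 => [|l nl].
    by rewrite !mxE eqxx mulr1 addr0.
  by rewrite !mxE (negPf nl) mulr0.
exact: mxrankM_maxl.
Qed.

(* On a wedge of eigenvectors of free_proj with eigenvalues 0 and 1,          *)
(* ext_der free_proj multiplies by the number of eigenvalues 1; this number   *)
(* lies in [1, r] because free_proj has corank less than r.                   *)
Lemma ext_der_free_proj_full : row_full (ext_der r free_proj).
Proof.
rewrite -sub1mx; apply/row_subP=> I; rewrite rowE mulmx1 -wedge_basis.
set A := rowsub _ _.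
have -> : wedge A = wedge (A *m (free_proj + (1 - free_proj))).
  by rewrite addrC subrK mulmx1.
rewrite wedge_mulD.
apply: summx_sub => S _; set B := split_mul _ _ _ _.
have BE : wedge B *m ext_der r free_proj = #|S|%:R *: wedge B.
  have [_ w0] := @wedge_alternating F r n.
  rewrite wedge_ext_der (bigID (mem S)) /= [X in _ + X]big1 ?addr0 =>
    [|j /negPf jS].
    rewrite (eq_bigr (fun => wedge B)) => [|j jS];
      first by rewrite sumr_const scaler_nat.
    by rewrite /mul_row rowK jS -mulmxA [free_proj *m _]free_proj_idem;
      congr wedge;
       apply/row_matrixP=> l; rewrite !rowK; case: eqP => [->|//]; rewrite jS.
  rewrite /mul_row rowK jS -mulmxA mulmxE mulrBl mul1r free_proj_idem subrr
    mulmx0.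
  exact: alt_set0 (@wedge_alternating F r n) _ _.
have [S0|] := posnP #|S|.
  rewrite wedge_rank_lt ?sub0mx //; apply: leq_ltn_trans free_proj_corank.
  have -> : B = A *m (1 - free_proj); last exact: mxrankM_maxr.
  apply/row_matrixP=> j; rewrite rowK row_mul.
  by move/eqP: S0; rewrite cards_eq0 => /eqP->; rewrite inE.
move=> S_gt0; have nz : #|S|%:R != 0 :> F.
  rewrite -(dvdn_pcharf pcharF) gtnNdvd //; apply: leq_ltn_trans ltrp.
  by rewrite -[X in (_ <= X)%N](card_ord r) max_card.
apply/submxP; exists (#|S|%:R^-1 *: wedge B).
by rewrite -scalemxAl BE scalerA mulVf // scale1r.
Qed.

(** The operator h = W V acts as a contracting homotopy. On a vector v killed by t, each bracket
    with T merely multiplies by t on the right, so v d(pi) = v d(h) t^(p-1). Since d(pi) is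
    invertible and commutes with t, its inverse preserves ker t. *)
Lemma ext_der_free_exact : p_exact p (ext_der r T).
Proof.
set t := ext_der r T; set h := W *m V.
have pE : free_proj = iter p.-1 (fun a => a * T - T * a) h.
  rewrite iter_adjoint prednK //; apply: eq_bigr => i _.
  rewrite -!mulrA -mulrnAl (sign_bin_pred p_pr) ?mul1r //;
    exact: mx_pchar0 pcharF _.
have pD q (v : 'rV_(ext_dim r n)) : v *m t = 0 ->
    v *m ext_der r (iter q (fun a =>
      a * T - T * a) h) = v *m ext_der r h *m t ^+ q.
  move=> vt; elim: q => [|q IH]; first by rewrite expr0 mulmx1.
  rewrite iterS ext_der_bracket mulmxBr !mulmxA IH vt mul0mx subr0.
  by rewrite -(mulmxA _ (t ^+ q) t) mulmxE -exprSr.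
have U : ext_der r free_proj \in unitmx by rewrite -row_full_unit
  ext_der_free_proj_full.
move=> v vt; have cU : GRing.comm t (ext_der r free_proj).
  exact: ext_der_comm free_proj_comm.
have v't : v *m invmx (ext_der r free_proj) *m t = 0.
  apply: (can_inj (mulmxK U));
    rewrite mul0mx -(mulmxA _ t) [t *m _]cU mulmxA mulmxKV //.
exists (v *m invmx (ext_der r free_proj) *m ext_der r h).
by rewrite -pD // -pE mulmxKV.
Qed.

End FreePart.

Section NotExact.

Variables (F : fieldType) (p r n : nat).

Lemma det_set_row (D : 'M[F]_r) j u :
  \det (set_row j u D) = \sum_l u 0 l * cofactor D j l.
Proof.
rewrite (expand_det_row _ j); apply: eq_bigr => l _; rewrite !mxE eqxx.
rewrite /cofactor; congr (_ * (_ * \det _)); apply/matrixP=> i m.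
by rewrite !mxE eq_sym (negPf (neq_lift _ _)) !mxE.
Qed.

(** Jacobi's formula for the derivative of the determinant at D in direction Y. *)
Lemma sum_det_set_row (Y D : 'M[F]_r) :
  \sum_j \det (set_row j (row j Y) D) = \tr (Y *m \adj D).
Proof.
rewrite /mxtrace; apply: eq_bigr => j _; rewrite det_set_row !mxE;
  apply: eq_bigr => l _.
by rewrite !mxE.
Qed.

(** The Cauchy-Binet formula, obtained from the universal property of the wedge. *)
Lemma wedge_tr_dot (A : 'M[F]_(r, n)) (B : 'M[F]_(n, r)) :
  (wedge A *m (wedge B^T)^T) 0 0 = \det (A *m B).
Proof.
have alt : alternating (fun A : 'M[F]_(r, n) => \det (A *m B) : F^o).
  have mul_set i v C : set_row i v C *m B = set_row i (v *m B) (C *m B).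
    by apply/row_matrixP=> j; rewrite row_mul !rowK row_mul; case: eqP.
  split=> [i C a u v|C i j nij eqij].
    rewrite !mul_set !det_set_row scaler_sumr -big_split;
      apply: eq_bigr => l _ /=.
    by rewrite mulmxDl -scalemxAl !mxE mulrDl -mulrA.
  apply: (determinant_alternate nij) => l.
  have /rowP/(_ l) : row i (C *m B) = row j (C *m B) by rewrite !row_mul eqij.
  by rewrite [LHS]mxE [RHS]mxE.
rewrite (ext_universal A alt) mxE; apply: eq_bigr => I _; congr (_ * _).
rewrite mul_rowsub_mx mul1mx !mxE -det_tr; congr (\det _).
by apply/matrixP=> i j; rewrite !mxE.
Qed.

(* The wedge of the rows of C is killed by ext_der T, and the wedge of the    *)
(* columns of B is a functional that kills the image of ext_der T but not that *)
(* vector.                                                                    *)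
Lemma ext_der_not_exact (T : 'M[F]_n) (C : 'M[F]_(r, n)) (B : 'M[F]_(n, r))
    (T1 T2 : 'M[F]_r) :
    (1 < p)%N -> C *m T = T1 *m C -> T *m B = B *m T2 ->
    \tr T1 = 0 -> \tr T2 = 0 -> \det (C *m B) != 0 ->
  ~ p_exact p (ext_der r T).
Proof.
move=> p_gt1 CT TB trT1 trT2 nz ex.
have Cd : wedge C *m ext_der r T = 0.
  rewrite wedge_ext_der; apply/rowP=> J; rewrite summxE [RHS]mxE.
  pose D := colsub (ext_fun J) C.
  transitivity (\sum_j \det (set_row j (row j (T1 *m D)) D)).
    apply: eq_bigr => j _; rewrite mxE; congr (\det _).
    apply/row_matrixP=> i; apply/rowP=> l.
    rewrite [LHS]mxE /mul_row -row_mul CT !rowK.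
    rewrite !mxE; case: eqP => _; rewrite !mxE //.
    by apply: eq_bigr => m _; rewrite mxE.
  rewrite sum_det_set_row -mulmxA mul_mx_adj mul_mx_scalar mxtraceZ trT1.
  by rewrite mulr0.
have dB : ext_der r T *m (wedge B^T)^T = 0.
  apply/row_matrixP=> I; rewrite row_mul rowE -wedge_basis wedge_ext_der row0.
  set A := rowsub _ _; apply/rowP=> l; rewrite ord1 mulmx_suml summxE [RHS]mxE.
  transitivity (\sum_j \det (set_row j (row j (A *m B *m T2)) (A *m B))).
    apply: eq_bigr => j _; rewrite wedge_tr_dot; congr (\det _).
    rewrite -(mulmxA A B) -TB mulmxA.
    apply/row_matrixP=> i; rewrite row_mul !row_mul !rowK !row_mul.
    by case: eqP.
  rewrite sum_det_set_row -mulmxA mxtrace_mulC -mulmxA mul_adj_mx mul_mx_scalar.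
  by rewrite mxtraceZ trT2 mulr0.
have [w wE] := ex _ Cd.
move: nz; rewrite -wedge_tr_dot wE -[p.-1]prednK ?ltn_predRL // exprSr -mulmxE.
by rewrite -!mulmxA dB !mulmx0 mxE eqxx.
Qed.

End NotExact.

Section Log1pTheory.

Variables (F : closedFieldType) (p n : nat) (X : 'M[F]_n).
Hypotheses (pcharF : p \in [pchar F]) (Xp0 : X ^+ p = 0).

Let p_pr : prime p := pcharf_prime pcharF.
Let p_gt0 : (0 < p)%N := prime_gt0 p_pr.

Let V : 'M[F]_n := \sum_(i < p.-1) ((-1) ^+ i / i.+1%:R) *: X ^+ i.

Let logE : log1p_mx p.-1 X = X * V.
Proof.
by rewrite mulr_sumr; apply: eq_bigr => i _;
  rewrite -mulmxE -scalemxAr mulmxE -exprS.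
Qed.

Let cXV : GRing.comm X V.
Proof. by apply: commr_sum => i _; apply/commrZ/commrX. Qed.

Lemma log1p_mx_exp : log1p_mx p.-1 X ^+ p = 0.
Proof. by rewrite logE exprMn_comm // Xp0 mul0r. Qed.

(** log(1 + X) = X V with V congruent to 1 modulo X, and X^p = 0 gives X^(p-1) V = X^(p-1). *)
Lemma log1p_mx_exp_pred : log1p_mx p.-1 X ^+ p.-1 = X ^+ p.-1.
Proof.
rewrite logE exprMn_comm //.
have XV : X ^+ p.-1 * V = X ^+ p.-1.
  have r_gt0 : (0 < p.-1)%N by rewrite ltn_predRL prime_gt1.
  rewrite mulr_sumr (bigD1 (Ordinal r_gt0)) //= big1 => [|[[|i] ilt] //= _].
    by rewrite !expr0 divr1 scale1r mulr1 addr0.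
  rewrite -mulmxE -scalemxAr mulmxE [X ^+ _.+1]exprS mulrA -exprSr prednK //
    Xp0 mul0r.
  by rewrite scaler0.
by elim: {2}p.-1 => [|j IH]; rewrite ?mulr1 // exprS mulrA XV.
Qed.

End Log1pTheory.

Lemma mulmx_log1p0 (F : closedFieldType) r m n (A : 'M[F]_(m, n)) X :
  A *m X = 0 -> A *m log1p_mx r X = 0.
Proof.
move=> AX; rewrite mulmx_sumr big1 // => i _.
by rewrite -scalemxAr exprS -mulmxE mulmxA AX mul0mx scaler0.
Qed.

Lemma log1p_mulmx0 (F : closedFieldType) r m n (A : 'M[F]_(n, m)) X :
  X *m A = 0 -> log1p_mx r X *m A = 0.
Proof.
move=> XA; rewrite mulmx_suml big1 // => i _.
by rewrite -scalemxAl exprSr -mulmxE -mulmxA XA mulmx0 scaler0.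
Qed.

(** Downward induction on j. Once all j > a are correct, subtracting N^(q-a) Th (Z N^a Th) cancels
    the error at a and, because N^(q+1) = 0, changes nothing above a. *)
Lemma dual_frame (F : fieldType) q k n (Z : 'M[F]_(k, n)) (N : 'M[F]_n)
    (Th0 : 'M[F]_(n, k)) :
    N ^+ q.+1 = 0 -> Z *m N ^+ q *m Th0 = 1%:M ->
  exists Th, forall j, (j <= q)%N -> Z *m N ^+ j *m Th = (j == q)%:R%:M.
Proof.
move=> N0 ZTh0.
have Nbig j : (q < j)%N -> N ^+ j = 0 by move=> lt;
  rewrite -(subnKC lt) exprD N0 mul0r.
suffices H i : exists Th, forall j, (q - i <= j <= q)%N ->
    Z *m N ^+ j *m Th = (j == q)%:R%:M.
  by have [Th ThE] := H q; exists Th => j jq; apply: ThE; rewrite subnn.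
elim: i => [|i [Th IH]].
  exists Th0 => j; rewrite subn0 => /andP[qj jq].
  have -> : j = q by apply/eqP; rewrite eqn_leq jq.
  by rewrite eqxx.
case: (leqP q i) => [qi|iq].
  by exists Th => j /andP[_ jq]; apply: IH; rewrite (_ : q - i = 0)%N ?jq //;
    apply/eqP.
pose a := (q - i.+1)%N; have aE : (a.+1 = q - i)%N by rewrite /a subnSK.
exists (Th - N ^+ i.+1 *m Th *m (Z *m N ^+ a *m Th)) => j /andP[aj jq].
have step : Z *m N ^+ j *m (N ^+ i.+1 *m Th *m (Z *m N ^+ a *m Th)) =
    Z *m N ^+ (j + i.+1) *m Th *m (Z *m N ^+ a *m Th).
  by rewrite exprD -mulmxE !mulmxA.
rewrite mulmxBr step; have [->|ne] := eqVneq j a.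
  rewrite subnK // IH; last by rewrite leq_subr leqnn.
  rewrite eqxx mul1mx subrr (_ : _ == _ = false) ?mulr0n ?raddf0 //.
  by apply/negbTE; rewrite neq_ltn /a ltn_subrL /=  (leq_ltn_trans _ iq).
have ltaj : (a < j)%N by rewrite ltn_neqAle eq_sym ne.
have ltq : (q < j + i.+1)%N by rewrite -[X in (X < _)%N](subnK iq) ltn_add2r.
rewrite [N ^+ (j + _)]Nbig // mulmx0 !mul0mx subr0.
by rewrite IH // -aE ltaj.
Qed.

(** By [ext_mx_log] the two operators differ by a sum of products of commuting p-nilpotent
    operators. *)
Lemma p_exact_ext_log (F : closedFieldType) p k d (X : 'I_k -> 'M[F]_d)
    (alpha : 'I_k -> F) :
    p \in [pchar F] -> (forall i j, GRing.comm (X i) (X j)) ->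
    (forall i, X i ^+ p = 0) ->
  p_exact p (\sum_i alpha i *: (ext_mx p.-1 (1%:M + X i) - 1%:M)) <->
  p_exact p (ext_der p.-1 (\sum_i alpha i *: log1p_mx p.-1 (X i))).
Proof.
move=> pcharF cX Xp0; have p_pr := pcharf_prime pcharF.
have ltrp : (p.-1 < p)%N by rewrite prednK ?prime_gt0.
have r_gt0 : (0 < p.-1)%N by rewrite ltn_predRL prime_gt1.
set r := p.-1 in ltrp r_gt0 *.
pose y (q : 'I_k * ('I_r * 'I_r)) := ext_der r (X q.1 ^+ q.2.2.+1).
(* The value 0 outside the range of [ext_mx_log] lets the sum run over all index pairs. *)
pose z (q : 'I_k * ('I_r * 'I_r)) : 'M[F]_(ext_dim r d) :=
  if (q.2.2 < q.2.1)%N then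
    (alpha q.1 * ((-1) ^+ q.2.2 / q.2.1.+1%:R)) *:
      ext_coef r (q.2.1 - q.2.2) (X q.1)
  else 0.
have cXn i j m l : GRing.comm (X i ^+ m) (X j ^+ l).
  by apply/commrX/commr_sym/commrX.
have clog i j m : GRing.comm (X i ^+ m) (log1p_mx r (X j)).
  by apply: commr_sum => l _; apply: commrZ.
pose L := \sum_i alpha i *: log1p_mx r (X i).
have cL i m : GRing.comm (X i ^+ m) L by apply: commr_sum => j _; apply: commrZ.
have lt_sub (q : 'I_r * 'I_r) : (q.1 - q.2 <= r)%N.
  by rewrite (leq_trans (leq_subr _ _)) // ltnW.
have cz q (A : 'M[F]_(ext_dim r d)) :
    (forall i l, GRing.comm A (ext_der r (X i ^+ l))) -> GRing.comm A (z q).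
  rewrite /z => cA; case: ifP => _; last exact: commr0.
  by apply/commrZ/(ext_coef_comm pcharF ltrp).
have tE : \sum_i alpha i *: (ext_mx r (1%:M + X i) - 1%:M) =
    ext_der r L + \sum_(q <- index_enum _) y q * z q.
  rewrite linear_sum -(pair_bigA _ (fun i q =>
    y (i, q) * z (i, q))) -big_split /=.
  apply: eq_bigr => i _;
    rewrite (ext_mx_log pcharF ltrp) -[1%:M + _ + _]addrA [1%:M + _]addrC addrK.
  rewrite scalerDr linearZ; congr (_ + _); rewrite scaler_sumr big_mkcond.
  apply: eq_bigr => q _; rewrite /z /y /=; case: ifP => _;
    last by rewrite mulr0.
  by rewrite -!mulmxE -!scalemxAr scalerA.
rewrite tE; apply: iff_sym; apply: p_exact_add_sum => //.
- by move=> q; apply/commr_sym/ext_der_comm.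
- by move=> q; apply: cz => i l; apply/commr_sym/ext_der_comm.
- by move=> q q'; apply: ext_der_comm.
- by move=> q q'; apply: cz => i l; apply: ext_der_comm.
- move=> q q'; apply: (cz q') => i l; apply/commr_sym; apply: (cz) => j m.
  exact: ext_der_comm.
- apply: (ext_der_exp_char pcharF ltrp) => //.
  rewrite (exprsum_char _ p_pr (mx_pchar0 pcharF d)) => [|i j].
    by rewrite big1 // => i _; rewrite exprZmx log1p_mx_exp // scaler0.
  apply/commrZ/commr_sym/commrZ/commr_sum => l _; apply: commrZ.
  by apply/commr_sym; exact: clog.
- move=> q; apply: (ext_der_exp_char pcharF ltrp) => //.
  by rewrite -exprM mulnC exprM Xp0 expr0n.
move=> q; rewrite /z; case: ifP => lt;
  last by rewrite expr0n gtn_eqF ?prime_gt0.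
rewrite exprZmx ext_coef_exp_char ?scaler0 //.
by rewrite subn_gt0 lt lt_sub.
Qed.

Lemma ext_shift_exp (F : closedFieldType) p r k d (X : 'I_k -> 'M[F]_d)
    (alpha : 'I_k -> F) :
    p \in [pchar F] -> (forall i j, GRing.comm (X i) (X j)) ->
    (forall i, X i ^+ p = 0) ->
  (\sum_i alpha i *: (ext_mx r (1%:M + X i) - 1%:M)) ^+ p = 0.
Proof.
move=> pcharF cX Xp0; have p_pr := pcharf_prime pcharF.
have pch m : p%:R = 0 :> 'M[F]_m := mx_pchar0 pcharF m.
have c1 m (A : 'M[F]_m) : GRing.comm A 1%:M := commr1 A.
have cE i j : GRing.comm (ext_mx r (1%:M + X i)) (ext_mx r (1%:M + X j)).
  rewrite /GRing.comm -!mulmxE -!ext_mxM; congr ext_mx; rewrite !mulmxE.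
  by apply: commrD => //; apply/commr_sym/commrD => //; apply/commr_sym.
rewrite (exprsum_char _ p_pr (pch _)) => [|i j].
  rewrite big1 // => i _; rewrite exprZmx (exprD_char p_pr (pch _));
    last exact/commrN/c1.
  have neg1 : (- 1%:M : 'M[F]_(ext_dim r d)) ^+ p = - 1%:M.
    have : (1%:M + (- 1%:M) : 'M[F]_(ext_dim r d)) ^+ p = 0.
      by rewrite subrr expr0n gtn_eqF ?prime_gt0.
    rewrite (exprD_char p_pr (pch _)); last exact/commrN/c1.
    by rewrite expr1n => /eqP; rewrite addrC addr_eq0 => /eqP.
  rewrite neg1 -ext_mxX (exprD_char p_pr (pch _)); last exact/commr_sym/c1.
  by rewrite expr1n Xp0 addr0 ext_mx1 subrr scaler0.
apply/commrZ/commr_sym/commrZ/commrB; last exact: c1.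
by apply/commr_sym/commrB; [exact: cE | exact: c1].
Qed.

(** * The natural module *)

Lemma commr_sum_pair (R : pzRingType) (I J : Type) (s : seq I) (s' : seq J)
    (f : I -> R) (g : J -> R) :
  (forall i j, GRing.comm (f i) (g j)) ->
  GRing.comm (\sum_(i <- s) f i) (\sum_(j <- s') g j).
Proof.
by move=> cfg; apply: commr_sum => j _; apply/commr_sym/commr_sum => i _;
  apply/commr_sym.
Qed.

Lemma row_diag_mul (F : fieldType) m n (D : 'rV[F]_m) (A : 'M[F]_(m, n)) i :
  row i (diag_mx D *m A) = D 0 i *: row i A.
Proof. by apply/rowP=> j; rewrite mul_diag_mx !mxE. Qed.

(** A vector x in the radical of the diagonal form b on the sum-zero space has all b_i x_i equal to
    some mu. Multiplying the sum of the x_i by the product of the b_i gives mu P = 0, so mu = 0;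
    then x_l P = 0 follows in the same way. *)
Lemma diag_form_sum0 (F : fieldType) k (b x : 'I_k -> F) mu :
    \sum_i x i = 0 -> (forall i, b i * x i = mu) ->
    \sum_i \prod_(j | j != i) b j != 0 ->
  forall i, x i = 0.
Proof.
set P := (X in X != 0) => x0 bx nz.
have bx_prod i j : i != j -> x i * \prod_(l | l != j) b l =
    mu * \prod_(l | (l != j) && (l != i)) b l.
  by move=> nij; rewrite (bigD1 i) //= mulrA [x i * _]mulrC bx.
have mu0 : mu = 0.
  apply: (mulIf nz); rewrite mul0r /P mulr_sumr.
  transitivity ((\sum_i x i) * \prod_i b i); last by rewrite x0 mul0r.
  rewrite mulr_suml; apply: eq_bigr => i _.
  by rewrite [in RHS](bigD1 i) //= -(bx i) mulrA [x i * _]mulrC.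
move=> l; apply: (mulIf nz); rewrite mul0r /P mulr_sumr (bigD1 l) //=.
rewrite [X in _ + X]big1 => [|i nil];
  last by rewrite bx_prod 1?eq_sym // mu0 mul0r.
rewrite addr0; have -> : x l = - \sum_(i | i != l) x i.
  by have := x0; rewrite (bigD1 l) //= => /eqP; rewrite addr_eq0 => /eqP.
rewrite mulNr mulr_suml big1 ?oppr0 // => i nil.
by rewrite bx_prod // mu0 mul0r.
Qed.

Lemma col_mulmx (R : pzSemiRingType) m n q (A : 'M[R]_(m, n)) (B : 'M_(n,
  q)) j :
  col j (A *m B) = A *m col j B.
Proof. by apply/matrixP=> i l; rewrite !mxE; apply: eq_bigr => h _;
  rewrite !mxE. Qed.

Lemma eq_col_matrix (R : Type) m n (A B : 'M[R]_(m, n)) :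
  (forall j, col j A = col j B) -> A = B.
Proof. by move=> eqAB; apply/trmx_inj/row_matrixP=> j;
  rewrite -!tr_col eqAB. Qed.

Section NaturalModuleModel.

(* X_i and Xd_i are g_i - 1 on the permutation module and on D(1); f and s are *)
(* the matrices of the projection from sum-zero vectors onto D(1) and of a    *)
(* lift; row i of Z is the first basis vector of the i-th block.              *)
Variables (F : closedFieldType) (p k n d : nat).
Hypothesis pcharF : p \in [pchar F].
Variables (X : 'I_k -> 'M[F]_n) (Xd : 'I_k -> 'M[F]_d).
Variables (f : 'M[F]_(n, d)) (s : 'M[F]_(d, n)) (Z : 'M[F]_(k, n)).
Let one : 'cV[F]_n := const_mx 1.
Let sg : 'rV[F]_n := const_mx 1.

Hypothesis X_orth : forall i j, i != j -> X i * X j = 0.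
Hypothesis X_exp : forall i, X i ^+ p = 0.
Hypothesis X_one : forall i, X i *m one = 0.
Hypothesis Z_X : forall i j, i != j -> row i Z *m X j = 0.
Hypothesis Z_one : Z *m one = const_mx 1.
Hypothesis Z_top : \sum_i row i Z *m X i ^+ p.-1 = sg.
Hypothesis Z_dual : exists Th0 : 'M_(n, k),
  (\matrix_i (row i Z *m X i ^+ p.-1)) *m Th0 = 1%:M.
Hypothesis f_X : forall i m (v : 'M_(m, n)),
  v *m one = 0 -> v *m X i *m f = v *m f *m Xd i.
Hypothesis s_f : s *m f = 1%:M.
Hypothesis s_one : s *m one = 0.
Hypothesis f_s : forall m (v : 'M_(m, n)),
  v *m one = 0 -> exists c : 'cV_m, v *m f *m s = v + c *m sg.
Hypothesis sg_f : sg *m f = 0.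
Hypothesis two_blocks : forall a b, a != b ->
  exists (C : 'M_(p.-1, n)) (B : 'M_(n, p.-1)),
  [/\ C *m one = 0, forall l, l != a -> C *m X l = 0,
      forall l, l != a -> l != b -> X l *m B = 0, sg *m B = 0 & C *m B = 1%:M].
Hypothesis k_gt0 : (0 < k)%N.
Hypothesis dim_d : (d < k.-1 * p + p.-1)%N.

Variable alpha : 'I_k -> F.

Let p_pr : prime p := pcharf_prime pcharF.
Let p_gt0 : (0 < p)%N := prime_gt0 p_pr.
Let p_gt1 : (1 < p)%N := prime_gt1 p_pr.
Let pch m : p%:R = 0 :> 'M[F]_m := mx_pchar0 pcharF m.

Let L i := log1p_mx p.-1 (X i).
Let N := \sum_i L i.
Let T := \sum_i alpha i *: L i.
Let Td := \sum_i alpha i *: log1p_mx p.-1 (Xd i).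

Let L_orth i j : i != j -> L i *m L j = 0.
Proof. by move=> nij; apply/mulmx_log1p0/log1p_mulmx0/X_orth. Qed.

Let L_comm i j : GRing.comm (L i) (L j).
Proof.
have [->//|nij] := eqVneq i j.
by rewrite /GRing.comm -!mulmxE !L_orth // eq_sym.
Qed.

Let L_one i : L i *m one = 0. Proof. exact/log1p_mulmx0/X_one. Qed.

Let L_exp i : L i ^+ p = 0. Proof. exact/log1p_mx_exp/X_exp. Qed.

Let L_top i : L i ^+ p.-1 = X i ^+ p.-1.
Proof. exact: log1p_mx_exp_pred. Qed.

Let N_exp : N ^+ p = 0.
Proof. by rewrite (exprsum_char _ p_pr (pch n)) // big1. Qed.

Let T_exp : T ^+ p = 0.
Proof.
rewrite (exprsum_char _ p_pr (pch n)) => [|i j].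
  by rewrite big1 // => i _; rewrite exprZmx L_exp scaler0.
by apply/commrZ/commr_sym/commrZ/L_comm.
Qed.

Let TN_comm : GRing.comm T N.
Proof. by apply: commr_sum_pair => i j; apply/commr_sym/commrZ/L_comm. Qed.

Let T_one : T *m one = 0.
Proof. by rewrite mulmx_suml big1 // => i _;
  rewrite -scalemxAl L_one scaler0. Qed.

Let ZL i j : i != j -> row i Z *m L j = 0.
Proof. by move=> nij; apply/mulmx_log1p0/Z_X. Qed.

Let row_ZN i j : row i (Z *m N ^+ j) = row i Z *m L i ^+ j.
Proof.
rewrite row_mul; elim: j => [|j IH]; first by rewrite !expr0.
rewrite !exprSr -mulmxE !mulmxA IH mulmx_sumr (bigD1 i) //= big1 ?addr0 // =>
  l li.
case: j {IH} => [|j]; first by rewrite expr0 mulmx1 ZL // eq_sym.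
by rewrite exprSr -mulmxE -!mulmxA L_orth 1?eq_sym // !mulmx0.
Qed.

Let ZT j : Z *m T ^+ j = diag_mx (\row_i alpha i ^+ j) *m (Z *m N ^+ j).
Proof.
have ZT1 : Z *m T = diag_mx (\row_i alpha i) *m (Z *m N).
  apply/row_matrixP=> i; rewrite row_mul row_diag_mul mxE.
  rewrite -[N]expr1 row_ZN expr1 mulmx_sumr (bigD1 i) //= big1 ?addr0 =>
    [|l li].
    by rewrite -scalemxAr.
  by rewrite -scalemxAr ZL ?scaler0 // eq_sym.
elim: j => [|j IH].
  rewrite !expr0 !mulmx1 -[LHS]mul1mx; congr (_ *m _).
  by rewrite -diag_const_mx; congr diag_mx; apply/rowP=> i; rewrite !mxE expr0.
rewrite exprSr -mulmxE mulmxA IH -!mulmxA [N ^+ j *m T](esym (commrX j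
  TN_comm)).
rewrite -mulmxE (mulmxA Z) ZT1 exprS -mulmxE !mulmxA; congr (_ *m _ *m _ *m _).
by rewrite mulmx_diag; congr diag_mx; apply/rowP=> i; rewrite !mxE exprSr.
Qed.

Let topE : Z *m N ^+ p.-1 = \matrix_i (row i Z *m X i ^+ p.-1).
Proof. by apply/row_matrixP=> i; rewrite row_ZN L_top rowK. Qed.

Let sgE : const_mx 1 *m (Z *m N ^+ p.-1) = sg.
Proof.
rewrite topE -Z_top mulmx_sum_row; apply: eq_bigr => i _.
by rewrite mxE scale1r rowK.
Qed.

Let dual : exists Th : 'M_(n, k), forall j,
  Z *m N ^+ j *m Th = (j == p.-1)%:R%:M.
Proof.
have [Th0 Th0E] := Z_dual.
have [||Th ThE] := @dual_frame F p.-1 k n Z N Th0; rewrite ?topE ?prednK //.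
exists Th => j; have [|lt] := leqP j p.-1; first exact: ThE.
rewrite -(subnKC lt) exprD prednK // N_exp mul0r mulmx0 mul0mx.
by rewrite gtn_eqF ?mulr0n ?raddf0 // prednK // leq_addr.
Qed.

Let one_X m (v : 'M_(m, n)) i j : v *m one = 0 -> v *m X i ^+ j *m one = 0.
Proof.
move=> v0; case: j => [|j]; first by rewrite expr0 mulmx1.
by rewrite exprSr -mulmxE -!mulmxA X_one !mulmx0.
Qed.

Let f_Xn i m (v : 'M_(m, n)) j :
  v *m one = 0 -> v *m X i ^+ j *m f = v *m f *m Xd i ^+ j.
Proof.
move=> v0; elim: j => [|j IH]; first by rewrite !expr0 !mulmx1.
by rewrite !exprSr -!mulmxE !mulmxA f_X ?one_X // IH.
Qed.

Let f_T m (v : 'M_(m, n)) : v *m one = 0 -> v *m T *m f = v *m f *m Td.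
Proof.
move=> v0; rewrite !mulmx_sumr mulmx_suml; apply: eq_bigr => i _.
rewrite -!scalemxAr -scalemxAl; congr (_ *: _).
rewrite !mulmx_sumr mulmx_suml; apply: eq_bigr => j _.
by rewrite -!scalemxAr -scalemxAl f_Xn.
Qed.

Let T_oneX m (v : 'M_(m, n)) j : v *m one = 0 -> v *m T ^+ j *m one = 0.
Proof.
move=> v0; case: j => [|j]; first by rewrite expr0 mulmx1.
by rewrite exprSr -mulmxE -!mulmxA T_one !mulmx0.
Qed.

Let f_Tn m (v : 'M_(m, n)) j :
  v *m one = 0 -> v *m T ^+ j *m f = v *m f *m Td ^+ j.
Proof.
move=> v0; elim: j => [|j IH]; first by rewrite !expr0 !mulmx1.
by rewrite !exprSr -!mulmxE !mulmxA f_T ?T_oneX // IH.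
Qed.

Let Td_exp : Td ^+ p = 0.
Proof. by rewrite -[Td ^+ p]mul1mx -s_f -f_Tn // T_exp mulmx0 mul0mx. Qed.

(** Functionals that kill the all-ones vector descend to D(1), with unchanged values on sum-zero
    vectors. *)
Let f_s_sg m q (v : 'M_(m, n)) (B : 'M_(n, q)) : v *m one = 0 -> sg *m B = 0 ->
  v *m f *m (s *m B) = v *m B.
Proof.
move=> v0 B0; have [c E] := f_s v0.
by rewrite mulmxA E mulmxDl -mulmxA B0 mulmx0 addr0.
Qed.

Definition gram_poly : F := \sum_i \prod_(j | j != i) alpha j ^+ p.-1.

Lemma exact_gram_poly_neq0 : gram_poly != 0 -> p_exact p (ext_der p.-1 Td).
Proof.
move=> nz; have [Th ThE] := dual.
pose b i := alpha i ^+ p.-1; pose Db := diag_mx (\row_i b i).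
have S_lt (i : 'I_k.-1) : (i.+1 < k)%N by rewrite -ltn_predRL.
pose o := Ordinal k_gt0; pose S i := Ordinal (S_lt i).
have S_inj i j : (S i == S j) = (i == j) by [].
(* The rows e_(i+1) - e_0 of D form a basis of the sum-zero vectors of F^k, so D Db D^T is the Gram
   matrix of the form. *)
pose D := \matrix_(i < k.-1,
  l < k) ((l == S i)%:R - (l == o)%:R) : 'M[F]_(k.-1, k).
have DM q (A : 'M_(k, q)) i j : (D *m A) i j = A (S i) j - A o j.
  rewrite mxE (eq_bigr (fun l => (l == S i)%:R * A l j - (l == o)%:R * A l j)).
    rewrite sumrB (bigD1 (S i)) //= eqxx mul1r big1 ?addr0 => [|l /negPf->].
      rewrite (bigD1 o) // big1 => [|l /negPf->]; last by rewrite mul0r.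
      by rewrite [X in _ - X]addr0 eqxx mul1r.
    by rewrite mul0r.
  by move=> l _; rewrite mxE mulrBl.
have D1 : D *m const_mx 1 = 0 :> 'cV_k.-1.
  by apply/matrixP=> i j; rewrite DM !mxE subrr.
have G_unit : D *m Db *m D^T \in unitmx.
  rewrite -row_free_unit; apply: inj_row_free => c cG.
  have [x xE] : exists x, x = c *m D by exists (c *m D).
  have x_sum : \sum_l x 0 l = 0.
    have /matrixP/(_ 0 0) : x *m const_mx 1 = 0 :> 'cV_1 by rewrite xE -mulmxA
      D1 mulmx0.
    by rewrite !mxE => E; rewrite -[RHS]E; apply: eq_bigr => l _;
      rewrite !mxE mulr1.
  have xb l : b l * x 0 l = b o * x 0 o.
    have [->//|nlo] := eqVneq l o.
    have l_gt0 : (0 < l)%N by rewrite lt0n.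
    have ltl : (l.-1 < k.-1)%N by rewrite -ltnS !prednK.
    have lE : l = S (Ordinal ltl) by apply/val_inj; rewrite /= prednK.
    have /matrixP/(_ (Ordinal ltl) 0) : D *m (x *m Db)^T = 0.
      by rewrite -[X in X *m _]trmxK -trmx_mul xE -!mulmxA [D *m (_ *m
        _)]mulmxA cG trmx0.
    rewrite DM -lE /Db mul_mx_diag !mxE => /eqP; rewrite subr_eq0 => /eqP.
    by rewrite mulrC [RHS]mulrC.
  have x0 := diag_form_sum0 x_sum xb nz.
  apply/rowP=> i; rewrite [RHS]mxE -[RHS](x0 (S i)) xE mxE (bigD1 i) //= big1
    => [|j].
    by rewrite mxE eqxx subr0 mulr1 addr0.
  by rewrite mxE S_inj eq_sym => /negPf->; rewrite subrr mulr0.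
(* Y normalises the pairing: D Db Y = 1. It also makes the functionals Th Y kill the all-ones
   vector. *)
pose Y := D^T *m invmx (D *m Db *m D^T).
have ThY0 : sg *m (Th *m Y) = 0.
  rewrite -sgE mulmxA -!(mulmxA (const_mx 1)) ThE eqxx mul1mx mulmxA.
  by rewrite -[const_mx 1 *m _]trmxK trmx_mul trmxK trmx_const D1 trmx0 mul0mx.
apply: (@ext_der_free_exact F p p.-1 d k.-1 _ _ Td (D *m Z *m f) (s *m (Th *m
  Y))) => //.
  by rewrite prednK.
move=> j ltjp; have DZ0 : D *m Z *m one = 0 by rewrite -mulmxA Z_one D1.
rewrite -f_Tn // f_s_sg ?T_oneX // -(mulmxA D Z) ZT.
rewrite mulmxA -(mulmxA D) -(mulmxA (diag_mx _)) ThE.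
case: eqP => [->|_]; last by rewrite !mulr0n !raddf0 ?mulmx0 ?mul0mx.
by rewrite mulmx1 mulmxA mulmxV.
Qed.

Let s_Td q (B : 'M_(n, q)) : sg *m B = 0 -> Td *m (s *m B) = s *m (T *m B).
Proof.
move=> B0; rewrite -[Td]mul1mx -s_f -f_T // f_s_sg ?mulmxA //.
by rewrite -mulmxA T_one mulmx0.
Qed.

Let not_exact_lift (C : 'M_(p.-1, n)) (B : 'M_(n, p.-1)) (T1 T2 : 'M[F]_p.-1) :
    C *m one = 0 -> sg *m B = 0 ->
    C *m T *m f = T1 *m C *m f -> s *m (T *m B) = s *m (B *m T2) ->
    \tr T1 = 0 -> \tr T2 = 0 -> \det (C *m B) != 0 ->
  ~ p_exact p (ext_der p.-1 Td).
Proof.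
move=> C1 B0 CT TB tr1 tr2 nz.
apply: (ext_der_not_exact (C := C *m f) (B := s *m B) (T1 := T1) (T2 :=
  T2)) => //.
- by rewrite -f_T // CT mulmxA.
- by rewrite s_Td // TB mulmxA.
- by rewrite f_s_sg.
Qed.

Let TjN j : T ^+ j * N = \sum_i alpha i ^+ j *: L i ^+ j.+1.
Proof.
elim: j => [|j IH].
  by rewrite expr0 mul1r; apply: eq_bigr => i _; rewrite expr0 scale1r expr1.
rewrite exprS -mulrA IH mulr_suml; apply: eq_bigr => i _.
rewrite mulr_sumr (bigD1 i) //= big1 ?addr0 => [|l li].
  by rewrite -!mulmxE -scalemxAl -scalemxAr scalerA -exprS mulmxE -exprS.
rewrite -!mulmxE -scalemxAl -scalemxAr [L l ^+ _]exprS -mulmxE mulmxA L_orth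
  1?eq_sym //.
by rewrite mul0mx !scaler0.
Qed.

(* The sum-zero vectors supported in block a form a trivial summand.          *)
Let not_exact_two_zeros a b :
  a != b -> alpha a = 0 -> alpha b = 0 -> ~ p_exact p (ext_der p.-1 Td).
Proof.
move=> nab a0 b0; have [C [B [C1 CX XB B0 CB]]] := two_blocks nab.
have CT : C *m T = 0.
  rewrite mulmx_sumr big1 // => l _; rewrite -scalemxAr.
  have [->|la] := eqVneq l a; first by rewrite a0 scale0r.
  by rewrite mulmx_log1p0 ?scaler0 ?CX.
have TB : T *m B = 0.
  rewrite mulmx_suml big1 // => l _; rewrite -scalemxAl.
  have [->|la] := eqVneq l a; first by rewrite a0 scale0r.
  have [->|lb] := eqVneq l b; first by rewrite b0 scale0r.
  by rewrite log1p_mulmx0 ?scaler0 ?XB.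
apply: (not_exact_lift (C := C) (B := B) (T1 := 0) (T2 := 0)) => //.
- by rewrite CT !mul0mx.
- by rewrite TB !mulmx0.
- exact: mxtrace0.
- exact: mxtrace0.
- by rewrite CB det1 oner_neq0.
Qed.

(* For v = \sum_i alpha_i^(1-p) e_i, where e_i is row i of Z, T^(p-1) v is the *)
(* all-ones vector, so v generates a Jordan block of size p-1 in D(1).        *)
Let not_exact_nonzero : (forall i, alpha i != 0) ->
  \sum_i (alpha i ^+ p.-1)^-1 = 0 -> ~ p_exact p (ext_der p.-1 Td).
Proof.
move=> nz sum0; have [Th ThE] := dual.
pose o := Ordinal k_gt0; pose a : 'rV_k := \row_i (alpha i ^+ p.-1)^-1.
(* The factor N makes psi kill the all-ones vector and gives T^(p-1) psi = 0. The pairing of v T^j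
   with psi is nonzero exactly for j = p-2. *)
pose v := a *m Z; pose psi := N *m col o Th.
have v1 : v *m one = 0.
  rewrite -mulmxA Z_one; apply/matrixP=> i j; rewrite !mxE -[RHS]sum0.
  by apply: eq_bigr => l _; rewrite !mxE mulr1.
have vT j : v *m T ^+ j = a *m diag_mx (\row_i alpha i ^+ j) *m (Z *m N ^+ j).
  by rewrite /v -(mulmxA a Z) ZT !mulmxA.
have vTf : v *m T ^+ p.-1 *m f = 0.
  rewrite vT (_ : a *m _ = const_mx 1) ?sgE //.
  by apply/rowP=> i; rewrite mul_mx_diag !mxE mulVf // expf_neq0.
have vTpsi j : v *m T ^+ j *m psi =
    ((j.+1 == p.-1)%:R * (alpha o ^+ p.-1)^-1 * alpha o ^+ j)%:M.
  have E : Z *m N ^+ j *m psi = (j.+1 == p.-1)%:R%:M *m delta_mx o 0.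
    by rewrite /psi colE -ThE exprSr -mulmxE !mulmxA.
  rewrite vT -mulmxA E mulmxA mul_mx_scalar -scalemxAl -colE mul_mx_diag.
  by apply/matrixP=> i i'; rewrite !ord1 !mxE eqxx mulr1n mulrA.
have sgN m : sg *m (T ^+ m *m psi) = 0.
  have sN : sg *m N = 0.
    have NN : N ^+ p.-1 * N = 0 by rewrite -exprSr prednK.
    by rewrite -sgE -!mulmxA [N ^+ _ *m N]NN !mulmx0.
  have cTN : T ^+ m *m N = N *m T ^+ m := esym (commrX m (commr_sym TN_comm)).
  by rewrite /psi (mulmxA (T ^+ m)) cTN !mulmxA sN !mul0mx.
have Tpsi : T ^+ p.-1 *m psi = 0.
  rewrite /psi mulmxA mulmxE TjN prednK // big1 ?mul0mx // => i _.
  by rewrite L_exp scaler0.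
pose C := \matrix_(i < p.-1) (v *m T ^+ i).
(* The powers decrease, so that C B is scalar and T acts on both frames by the same nilpotent shift
   [T1]. *)
pose B := (\matrix_(j < p.-1) (T ^+ (p.-2 - j) *m psi)^T)^T.
have colB j : col j B = T ^+ (p.-2 - j) *m psi by rewrite -tr_row rowK trmxK.
pose T1 : 'M[F]_p.-1 := \matrix_(i, j) (j == i.+1 :> nat)%:R.
have T1tr : \tr T1 = 0.
  by rewrite /mxtrace big1 // => i _; rewrite mxE ltn_eqF.
apply: (not_exact_lift (C := C) (B := B) (T1 := T1) (T2 := T1)) => //.
- by apply/row_matrixP=> i; rewrite row_mul rowK T_oneX // row0.
- by apply: eq_col_matrix => j; rewrite col_mulmx colB sgN raddf0.
- apply/row_matrixP=> i; rewrite !row_mul rowK -(mulmxA v) -[T ^+ i *m T]exprSr.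
  have [lti|] := ltnP i.+1 p.-1.
    have -> : row i T1 = delta_mx 0 (Ordinal lti).
      by apply/rowP=> j; rewrite !mxE -val_eqE.
    by rewrite -rowE rowK.
  move=> lei; have -> : i.+1 = p.-1 by apply/eqP; rewrite eqn_leq lei ltn_ord.
  rewrite vTf (_ : row i T1 = 0) ?mul0mx //; apply/rowP=> j; rewrite !mxE.
  by rewrite ltn_eqF // (leq_trans _ lei).
- congr (s *m _); apply: eq_col_matrix => j;
  rewrite !col_mulmx colB mulmxA -[T *m T ^+ _]exprS.
  case: (posnP j) => [j0|j_gt0].
    have -> : (p.-2 - j).+1 = p.-1 by rewrite j0 subn0 prednK // ltn_predRL.
    rewrite Tpsi (_ : col j T1 = 0) ?mulmx0 //; apply/colP=> l.
    by rewrite !mxE j0.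
  have ltj : (j.-1 < p.-1)%N by apply: leq_ltn_trans (leq_pred _) _.
  have -> : col j T1 = delta_mx (Ordinal ltj) 0.
    apply/colP=> l; rewrite !mxE andbT -val_eqE /= -[in LHS](prednK j_gt0) eqSS.
    by rewrite eq_sym.
  rewrite -colE colB /=; congr (T ^+ _ *m _).
  have lejp : (j <= p.-2)%N by rewrite -ltnS prednK // ltn_predRL.
  by rewrite -{1}(prednK j_gt0) subnSK // prednK.
pose c := (alpha o ^+ p.-1)^-1 * alpha o ^+ p.-2.
have -> : C *m B = c%:M.
  apply/matrixP=> i j; have -> : (C *m B) i j = (row i C *m col j B) 0 0.
    by rewrite !mxE; apply: eq_bigr => l _; rewrite !mxE.
  rewrite rowK colB mulmxA -(mulmxA v) -[T ^+ i *m T ^+ _]exprD vTpsi !mxE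
    eqxx mulr1n.
  have lejp : (j <= p.-2)%N by rewrite -ltnS prednK // ltn_predRL.
  have -> : ((i + (p.-2 - j)).+1 == p.-1) = (i == j).
    have e1 : p.-1 = (j + (p.-2 - j)).+1 by rewrite subnKC // prednK //
      ltn_predRL.
    by rewrite [X in _ == X]e1 eqSS eqn_add2r.
  case: eqP => [->|_]; last by rewrite !mul0r.
  by rewrite subnKC // mul1r.
by rewrite det_scalar expf_neq0 // mulf_neq0 ?invr_neq0 ?expf_neq0.
Qed.

Lemma exact_gram_polyP : p_exact p (ext_der p.-1 Td) <-> gram_poly != 0.
Proof.
split; last exact: exact_gram_poly_neq0.
move=> ex; apply/negP=> /eqP g0.
have p1_gt0 : (0 < p.-1)%N by rewrite ltn_predRL.
have [/forallP nz|/forallPn[a]] := boolP [forall i, alpha i != 0].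
  apply: (not_exact_nonzero nz _ ex).
  have P_neq0 : \prod_i alpha i ^+ p.-1 != 0.
    by apply/prodf_neq0 => i _; apply: expf_neq0.
  (* Multiplication by the product of all alpha_i^(p-1) turns the sum of inverses into
     [gram_poly]. *)
  apply: (mulIf P_neq0); rewrite mul0r -[RHS]g0 mulr_suml;
    apply: eq_bigr => i _.
  by rewrite (bigD1 i) //= mulrA mulVf ?mul1r // expf_neq0.
rewrite negbK => /eqP a0; move: g0.
(* Only the term omitting a survives; since it vanishes too, there is a second index b with alpha_b
   = 0. *)
have zero_term i : i != a -> \prod_(j | j != i) alpha j ^+ p.-1 = 0.
  by move=> nia; rewrite (bigD1 a) 1?eq_sym //= a0 expr0n gtn_eqF ?mul0r.
rewrite /gram_poly (bigD1 a) //= [X in _ + X]big1 // addr0 => /eqP.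
rewrite prodf_seq_eq0 => /hasP[b _ /andP[nba]];
  rewrite expf_eq0 => /andP[_ /eqP b0].
by apply: (not_exact_two_zeros (a := a) (b := b)) ex; rewrite 1?eq_sym.
Qed.

Lemma model_comm i j : GRing.comm (Xd i) (Xd j).
Proof.
have [->//|nij] := eqVneq i j.
suffices XX0 l l' : l != l' -> Xd l * Xd l' = 0.
  by rewrite /GRing.comm !XX0 // eq_sym.
move=> nll'; rewrite -[LHS]mul1mx -s_f -mulmxE mulmxA -f_X // -f_X.
  by rewrite -(mulmxA s) [X l *m _]X_orth // mulmx0 mul0mx.
by rewrite -mulmxA X_one mulmx0.
Qed.

Lemma model_exp i : Xd i ^+ p = 0.
Proof. by rewrite -[LHS]mul1mx -s_f -f_Xn // X_exp mulmx0 mul0mx. Qed.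

Lemma model_exactP :
  p_exact p (\sum_i alpha i *: (ext_mx p.-1 (1%:M + Xd i) - 1%:M)) <->
  gram_poly != 0.
Proof.
rewrite -exact_gram_polyP; apply: p_exact_ext_log => //.
  exact: model_comm.
exact: model_exp.
Qed.

End NaturalModuleModel.

(** * Comparison with bases over the cyclic group algebra *)

Section FreeExact.

Variables (F : fieldType) (p n : nat) (t : 'M[F]_n).
Hypotheses (p_gt0 : (0 < p)%N) (tp0 : t ^+ p = 0).

Let comb m (b : 'I_m -> 'rV[F]_n) (U : 'M[F]_n) (c : 'M[F]_(m, p)) :=
  \sum_j b j *m (\sum_(i < p) c j i *: U ^+ i).

Lemma combE m (b : 'I_m -> 'rV[F]_n) (c : 'M[F]_(m, p)) :
  comb b t c = \sum_(i < p) (col i c)^T *m (\matrix_j b j) *m t ^+ i.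
Proof.
rewrite /comb; under eq_bigr do rewrite mulmx_sumr.
rewrite exchange_big; apply: eq_bigr => i _ /=.
rewrite [X in _ = X *m _]mulmx_sum_row mulmx_suml; apply: eq_bigr => j _.
by rewrite rowK !mxE -scalemxAl -scalemxAr.
Qed.

(** The unitriangular change of basis between the powers of 1 + t and those of t. *)
Definition binom_mx : 'M[F]_p := \matrix_(i, l) ('C(i, l))%:R.

Lemma binom_mx_unit : binom_mx \in unitmx.
Proof.
rewrite unitmxE det_trig.
  rewrite big1 ?unitr1 // => i _; by rewrite mxE binn.
by apply/is_trig_mxP => i j ltij; rewrite mxE bin_small.
Qed.

Lemma comb_binom m (b : 'I_m -> 'rV[F]_n) (c : 'M[F]_(m, p)) :
  comb b (1 + t) c = comb b t (c *m binom_mx).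
Proof.
apply: eq_bigr => j _; congr (_ *m _).
under [RHS]eq_bigr do rewrite mxE scaler_suml.
rewrite exchange_big; apply: eq_bigr => i _ /=.
rewrite exprDn_comm; last exact/commr_sym/commr1.
rewrite -(big_mkord xpredT (fun l => 1 ^+ (i - l) * t ^+ l *+ 'C(i, l))).
rewrite (big_nat_widen _ _ p) // big_mkord big_mkcond scaler_sumr.
apply: eq_bigr => l _; rewrite mxE /=; case: ltnP => [_|lt].
  by rewrite expr1n mul1r -scalerA scaler_nat.
by rewrite bin_small // mulr0 scale0r scaler0.
Qed.

Let combR m (b : 'I_m -> 'rV[F]_n) (a : nat -> 'rV[F]_m) :=
  \sum_(i < p) a i *m (\matrix_j b j) *m t ^+ i.

Lemma comb_combR m (b : 'I_m -> 'rV[F]_n) (a : nat -> 'rV[F]_m) :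
  comb b t (\matrix_(j, i) a i 0 j) = combR b a.
Proof.
rewrite combE; apply: eq_bigr => i _; congr (_ *m _ *m _).
by apply/rowP=> j; rewrite !mxE.
Qed.

Lemma combR_comb m (b : 'I_m -> 'rV[F]_n) (c : 'M[F]_(m, p)) :
  comb b t c = combR b (fun i => if insub i is Some o then (col o c)^T else 0).
Proof. by rewrite combE; apply: eq_bigr => i _; rewrite valK. Qed.

(** If v t = 0, the coefficients of v shifted by one degree represent 0. Uniqueness leaves only the
    top coefficient of v. *)
Lemma free_p_exact m (b : 'I_m -> 'rV[F]_n) :
  (forall v, exists! c, v = comb b t c) -> p_exact p t.
Proof.
move=> free v vt; have [c [vE _]] := free v.
pose a i : 'rV[F]_m := if insub i is Some o then (col o c)^T else 0.
pose a' i : 'rV[F]_m := if i is i'.+1 then a i' else 0.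
pose g i := a' i *m (\matrix_j b j) *m t ^+ i.
have a'0 : \matrix_(j < m, i < p) a' i 0 j = 0 :> 'M[F]_(m, p).
  have [c0 [_ uc0]] := free 0.
  transitivity c0; [symmetry|]; apply: uc0; last first.
    by rewrite /comb big1 // => j _; rewrite big1 ?mulmx0 // => i _;
      rewrite mxE scale0r.
  rewrite comb_combR -vt vE combR_comb -/a mulmx_suml.
  transitivity (\sum_(i < p) g i.+1).
    by apply: eq_bigr => i _; rewrite /g exprSr -mulmxE !mulmxA.
  apply: (addrI (g 0%N)); rewrite -(big_ord_recl _ (fun i : 'I_p.+1 => g i)).
  by rewrite big_ord_recr /= {2 3}/g /= tp0 mulmx0 !mul0mx add0r addr0.
exists (a p.-1 *m (\matrix_j b j)); rewrite vE combR_comb -/a /combR.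
have ltp : (p.-1 < p)%N by rewrite prednK.
rewrite (bigD1 (Ordinal ltp)) //= big1 ?addr0 // => i ne.
have lti : (i.+1 < p)%N.
  rewrite -[X in (_ < X)%N](prednK p_gt0) ltnS ltn_neqAle -ltnS prednK //
    ltn_ord andbT.
  by apply: contra ne => /eqP e; apply/eqP/val_inj.
suffices -> : a i = 0 by rewrite !mul0mx.
apply/rowP=> j; have /matrixP/(_ j (Ordinal lti)) := a'0.
by rewrite !mxE.
Qed.

(** A basis of im t^(p-1) is lifted through t^(p-1). The lift generates by induction on e with v t^e
    = 0; independence follows by isolating the lowest coefficient with a power of t. *)
Lemma p_exact_free : p_exact p t ->
  exists m (b : 'I_m -> 'rV[F]_n), forall v, exists! c, v = comb b t c.
Proof.
move=> ex; set q := t ^+ p.-1; pose B := row_base q *m pinvmx q.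
have BqE : B *m q = row_base q by rewrite mulmxKpV // eq_row_base.
have matB : \matrix_j row j B = B by apply/row_matrixP=> j; rewrite rowK.
exists (\rank q), (fun j => row j B).
have gen e (v : 'rV_n) : (e <= p)%N -> v *m t ^+ e = 0 ->
    exists a, v = combR (fun j => row j B) a.
  elim: e v => [|e IH] v lep.
    rewrite expr0 mulmx1 => ->; exists (fun=> 0).
    by rewrite /combR big1 // => i _; rewrite !mul0mx.
  rewrite exprSr -mulmxE mulmxA => /ex[w wE].
  have /submxP[x xE] : (w *m q <= row_base q)%MS by rewrite eq_row_base submxMl.
  have ltj : (p.-1 - e < p)%N by rewrite (leq_ltn_trans (leq_subr _ _)) ?prednK.
  have [|a aE] := IH (v - x *m B *m t ^+ (p.-1 - e)) (ltnW lep).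
    rewrite mulmxBl -(mulmxA _ _ (t ^+ e)) -[_ ^+ _ *m _]exprD subnK -1?ltnS
      ?prednK //.
    by rewrite -mulmxA BqE -xE wE subrr.
  exists (fun i => a i + (i == p.-1 - e)%N%:R *: x).
  rewrite -[v](subrK (x *m B *m t ^+ (p.-1 - e))) aE /combR matB.
  under [RHS]eq_bigr do rewrite mulmxDl mulmxDl.
  rewrite big_split /=; congr (_ + _).
  rewrite (bigD1 (Ordinal ltj)) //= eqxx scale1r big1 ?addr0 // => i.
  by rewrite -val_eqE /= => /negPf->; rewrite scale0r !mul0mx.
have indep (a : nat -> 'rV_(\rank q)) : combR (fun j => row j B) a = 0 ->
    forall i, (i < p)%N -> a i = 0.
  rewrite /combR matB => a0; elim/ltn_ind => i IH ltip.
  have : (\sum_(l < p) a l *m B *m t ^+ l) *m t ^+ (p.-1 - i) = 0.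
    by rewrite a0 mul0mx.
  rewrite mulmx_suml (bigD1 (Ordinal ltip)) //= big1 ?addr0 => [|l ne].
    rewrite -mulmxA -[_ *m t ^+ _]exprD subnKC -1?ltnS ?prednK // -mulmxA BqE.
    move/(congr1 (fun u => u *m pinvmx (row_base q))).
    by rewrite mulmxKp ?mul0mx // row_base_free.
  case: (ltngtP l i) => [lt|lt|e]; last by rewrite -val_eqE /= e eqxx in ne.
    by rewrite IH // !mul0mx.
  have le : (p <= l + (p.-1 - i))%N.
    have e : p = (i.+1 + (p.-1 - i))%N by rewrite addSn subnKC ?prednK //
      -ltnS prednK.
    by rewrite [X in (X <= _)%N]e leq_add2r.
  by rewrite -mulmxA -[_ *m t ^+ _]exprD -(subnKC le) exprD tp0 mul0r mulmx0.
move=> v; have [|a aE] := gen p v (leqnn p); first by rewrite tp0 mulmx0.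
exists (\matrix_(j, i) a i 0 j); split; first by rewrite comb_combR.
move=> c; rewrite combR_comb aE => /eqP; rewrite -subr_eq0 -sumrB => /eqP E.
pose a' i : 'rV[F]_(\rank q) := if insub i is Some o then (col o c)^T else 0.
have {}E : combR (fun j => row j B) (fun i => a i - a' i) = 0.
  by rewrite -[RHS]E; apply: eq_bigr => i _; rewrite !mulmxBl.
apply/matrixP=> j i; have /rowP/(_ j) := indep _ E i (ltn_ord i).
by rewrite /a' valK !mxE => /eqP; rewrite subr_eq0 => /eqP.
Qed.

Lemma free_exactP :
  (exists m (b : 'I_m -> 'rV[F]_n), forall v, exists! c,
    v = comb b (1 + t) c) <->
  p_exact p t.
Proof.
split=> [[m [b free]]|/p_exact_free[m [b free]]].
  apply: (free_p_exact (b := b)) => v; have [c [vE uc]] := free v.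
  exists (c *m binom_mx); split; first by rewrite -comb_binom.
  move=> c'; rewrite -[c'](mulmxKV binom_mx_unit) -comb_binom => /uc->.
  by [].
exists m, b => v; have [c [vE uc]] := free v.
exists (c *m invmx binom_mx); split;
  first by rewrite comb_binom mulmxKV // binom_mx_unit.
move=> c'; rewrite comb_binom => /uc->; rewrite mulmxK //; exact: binom_mx_unit.
Qed.

End FreeExact.

(** * The permutation matrices of the p-cycles *)

Section Blocks.

Variables (k p : nat).

Lemma block_point_lt (i : 'I_k) (j : 'I_p) : (i * p + j < k * p)%N.
Proof.
by apply: leq_trans (_ : i.+1 * p <= _)%N;
  rewrite ?leq_mul2r ?ltn_ord ?orbT // mulSnr ltn_add2l.
Qed.

Definition block_point i j : 'I_(k * p) := Ordinal (block_point_lt i j).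

Lemma block_pointP (x : 'I_(k * p)) : exists i j, x = block_point i j.
Proof.
have p_gt0 : (0 < p)%N.
  by have := leq_ltn_trans (leq0n x) (ltn_ord x); rewrite muln_gt0 => /andP[].
have lti : (x %/ p < k)%N by rewrite ltn_divLR.
have ltj : (x %% p < p)%N by rewrite ltn_mod.
exists (Ordinal lti), (Ordinal ltj); apply/val_inj; exact: divn_eq.
Qed.

Lemma eq_block_point i j i' j' :
  (block_point i j == block_point i' j') = (i == i') && (j == j').
Proof.
apply/eqP/andP=> [/(congr1 val) /= e|[/eqP-> /eqP->]//].
have p_gt0 : (0 < p)%N := leq_ltn_trans (leq0n j) (ltn_ord j).
split; rewrite -val_eqE /=; apply/eqP.
  by have := congr1 (fun x => x %/ p)%N e;
    rewrite /= !divnMDl // !divn_small ?addn0.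
by have := congr1 (fun x => x %% p)%N e; rewrite /= !modnMDl !modn_small.
Qed.

Lemma mem_block_point i i' j : (block_point i j \in block p i') = (i == i').
Proof.
rewrite mem_filter mem_enum andbT /=; apply/andP/eqP => [[le lt]|<-].
  apply/val_inj/eqP; rewrite eqn_leq /=;
    have p_gt0 : (0 < p)%N := leq_ltn_trans (leq0n j) (ltn_ord j).
  have e : ((i * p + j) %/ p = i)%N by rewrite divnMDl // divn_small ?addn0.
  by rewrite -ltnS -{1}e ltn_divLR // lt -[X in (_ <= X)%N]e leq_divRL.
by rewrite leq_addr mulSnr ltn_add2l.
Qed.

Lemma Egen_fix (i i' : 'I_k) j : i != i' -> Egen p i' (block_point i j) =
  block_point i j.
Proof.
by move=> ne; rewrite EgenE next_nth mem_block_point (negPf ne).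
Qed.

Lemma Egen_block i j : exists j', Egen p i (block_point i j) = block_point i j'.
Proof.
rewrite EgenE; have : next (block p i) (block_point i j) \in block p i.
  by rewrite mem_next mem_block_point.
have [i' [j' ->]] := block_pointP (next (block p i) (block_point i j)).
by rewrite mem_block_point => /eqP->; exists j'.
Qed.

Lemma Egen_next i j :
  val (Egen p i (block_point i j)) = (i * p + (if j.+1 < p then j.+1 else 0))%N.
Proof.
rewrite EgenE -(next_map val_inj) ?block_uniq // block_val /=.
have p_gt0 : (0 < p)%N := leq_ltn_trans (leq0n j) (ltn_ord j).
rewrite next_nth mem_iota leq_addr ltn_add2l ltn_ord.
have -> : index (i * p + j)%N (iota (i * p) p) = j.
  by rewrite -{1}(nth_iota 0 (i * p) (ltn_ord j)) index_uniq ?size_iota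
    ?iota_uniq.
have -> : iota (i * p) p = (i * p)%N :: iota (i * p).+1 p.-1 by case: (p) p_gt0.
case: ifP => lt.
  by rewrite nth_iota ?addSnnS // -ltnS prednK.
by rewrite nth_default ?addn0 // size_iota -ltnS prednK // leqNgt lt.
Qed.

Lemma Egen_iter i (j0 : 'I_p) j : j0 = 0%N :> nat -> (j < p)%N ->
  val ((Egen p i ^+ j)%g (block_point i j0)) = (i * p + j)%N.
Proof.
move=> j00; elim: j => [|j IH] ltj; first by rewrite expg0 perm1 /= j00.
rewrite expgSr permM (_ : (Egen p i ^+ j)%g _ = block_point i (Ordinal (ltnW
  ltj))).
  by rewrite Egen_next /= ltj.
by apply/val_inj; rewrite IH // ltnW.
Qed.

Lemma Egen_exp i : (Egen p i ^+ p = 1 :> 'S_(k * p))%g.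
Proof.
apply/permP=> x; rewrite perm1; have [i' [j ->]] := block_pointP x.
have p_gt0 : (0 < p)%N := leq_ltn_trans (leq0n j) (ltn_ord j).
have [<-|ne] := eqVneq i' i; last first.
  have fixq q : iter q (Egen p i) (block_point i' j) = block_point i' j.
    by elim: q => //= q ->; rewrite Egen_fix.
  by rewrite permX.
pose j0 := Ordinal p_gt0.
have -> : block_point i' j = (Egen p i' ^+ j)%g (block_point i' j0).
  by apply/val_inj; rewrite Egen_iter.
rewrite -permM -expgD addnC expgD permM; congr (fun_of_perm _ _).
have ltp : (p.-1 < p)%N by rewrite prednK.
have -> : (Egen p i' ^+ p = Egen p i' ^+ p.-1 * Egen p i')%g by rewrite
  -expgSr prednK.
rewrite permM.
have -> : (Egen p i' ^+ p.-1)%g (block_point i' j0) = block_point i' (Ordinal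
  ltp).
  by apply/val_inj; rewrite Egen_iter.
by apply/val_inj; rewrite Egen_next /= prednK // ltnn.
Qed.

End Blocks.

Section BlockMatrices.

Variables (F : fieldType) (p k : nat).
Hypothesis pcharF : p \in [pchar F].
Let n := (k * p)%N.
Let p_pr : prime p := pcharf_prime pcharF.
Let p_gt0 : (0 < p)%N := prime_gt0 p_pr.
Let j0 : 'I_p := Ordinal p_gt0.

Definition block_nilp (i : 'I_k) : 'M[F]_(k * p) := perm_mx (Egen p i) - 1%:M.

Definition block_origin : 'M[F]_(k, k * p) :=
  \matrix_i delta_mx 0 (block_point i j0).

Lemma row_perm_mx (s : 'S_(k * p)) x : row x (perm_mx s : 'M[F]__) = delta_mx
  0 (s x).
Proof. by apply/rowP=> y; rewrite !mxE eqxx eq_sym. Qed.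

Lemma row_block_nilp i x :
  row x (block_nilp i) = delta_mx 0 (Egen p i x) - delta_mx 0 x.
Proof. by rewrite linearB /= row_perm_mx row1. Qed.

Lemma row_block_nilp0 i i' j : i != i' -> row (block_point i j) (block_nilp
  i') = 0.
Proof. by move=> ne; rewrite row_block_nilp Egen_fix // subrr. Qed.

Lemma delta_block_nilp0 i i' j : i != i' ->
  delta_mx 0 (block_point i j) *m block_nilp i' = 0 :> 'rV_(k * p).
Proof. by move=> ne; rewrite -rowE row_block_nilp0. Qed.

Lemma block_nilp_orth i i' : i != i' -> block_nilp i * block_nilp i' = 0.
Proof.
move=> ne; apply/row_matrixP=> x; rewrite row_mul row0.
have [l [j ->]] := block_pointP x.
have [li|li] := eqVneq l i; last by rewrite row_block_nilp0 // mul0mx.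
rewrite {}li row_block_nilp mulmxBl; have [j' ->] := Egen_block i j.
by rewrite !delta_block_nilp0 // subrr.
Qed.

Lemma perm_mxX (s : 'S_(k * p)) m : perm_mx (s ^+ m)%g = perm_mx s ^+ m :>
  'M[F]__.
Proof.
elim: m => [|m IH]; first by rewrite expg0 perm_mx1.
by rewrite expgS perm_mxM IH exprS.
Qed.

Lemma block_nilp_exp i : block_nilp i ^+ p = 0.
Proof.
have e : perm_mx (Egen p i) = 1 + block_nilp i by rewrite addrC subrK.
have : perm_mx (Egen p i) ^+ p = 1 + block_nilp i ^+ p :> 'M[F]_(k * p).
  rewrite e (exprD_char p_pr (mx_pchar0 pcharF _)) ?expr1n //.
  exact/commr_sym/commr1.
rewrite -perm_mxX Egen_exp perm_mx1 => /eqP.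
by rewrite -subr_eq0 opprD addrA subrr sub0r oppr_eq0 => /eqP.
Qed.

Lemma block_nilp_one i : block_nilp i *m const_mx 1 = 0 :> 'cV_(k * p).
Proof.
apply/row_matrixP=> x; rewrite row_mul row_block_nilp mulmxBl -!rowE !row_const.
by rewrite subrr.
Qed.

Lemma row_block_origin i : row i block_origin = delta_mx 0 (block_point i j0).
Proof. by rewrite rowK. Qed.

Lemma block_origin_nilp i i' : i != i' -> row i block_origin *m block_nilp i'
  = 0.
Proof. by move=> ne; rewrite row_block_origin delta_block_nilp0. Qed.

Lemma block_origin_one : block_origin *m const_mx 1 = const_mx 1 :> 'cV_k.
Proof.
by apply/row_matrixP=> i; rewrite row_mul row_block_origin -rowE !row_const.
Qed.

(** In characteristic p, (g_i - 1)^(p-1) is the sum of all powers of g_i, which move the first point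
    once through its block. *)
Lemma block_origin_nilp_pred i :
  row i block_origin *m block_nilp i ^+ p.-1 =
  \sum_(j < p) delta_mx 0 (block_point i j).
Proof.
rewrite row_block_origin (exprB_pred p_pr (mx_pchar0 pcharF _));
  last exact: commr1.
rewrite mulmx_sumr (reindex_inj rev_ord_inj); apply: eq_bigr => j _ /=.
have -> : (p.-1 - (p - j.+1) = j)%N.
  have -> : (p - j.+1 = p.-1 - j)%N by rewrite -subn1 -subnDA add1n.
  by rewrite subKn // -ltnS prednK.
rewrite expr1n mulr1 -perm_mxX -rowE row_perm_mx; congr (delta_mx _ _).
by apply/val_inj; rewrite Egen_iter.
Qed.

Lemma block_origin_top : \sum_i row i block_origin *m block_nilp i ^+ p.-1 =
  const_mx 1.
Proof.
apply/rowP=> x; have [i [j ->]] := block_pointP x.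
rewrite summxE (bigD1 i) //= big1 => [|i' ne];
  rewrite block_origin_nilp_pred summxE.
  rewrite (bigD1 j) //= big1 => [|j' ne]; rewrite !mxE ?eqxx ?addr0 //=.
  by rewrite eq_block_point eqxx eq_sym (negPf ne).
by rewrite big1 // => j' _; rewrite mxE eq_block_point eq_sym (negPf ne).
Qed.

Lemma block_origin_dual : exists Th0 : 'M[F]_(k * p, k),
  (\matrix_i (row i block_origin *m block_nilp i ^+ p.-1)) *m Th0 = 1%:M.
Proof.
exists block_origin^T; apply/row_matrixP=> i; rewrite row_mul rowK.
rewrite block_origin_nilp_pred row1 mulmx_suml (bigD1 j0) //= big1 => [|j ne].
  rewrite addr0 -rowE; apply/rowP=> i'; rewrite !mxE eq_block_point !eqxx /=.
  by rewrite andbT eq_sym.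
rewrite -rowE; apply/rowP=> i'; rewrite !mxE eq_block_point (negPf ne).
by rewrite andbF.
Qed.

Lemma two_block_frames a b : a != b ->
  exists (C : 'M[F]_(p.-1, k * p)) (B : 'M[F]_(k * p, p.-1)),
  [/\ C *m const_mx 1 = 0 :> 'cV_p.-1, forall l,
    l != a -> C *m block_nilp l = 0,
      forall l, l != a -> l != b -> block_nilp l *m B = 0,
      const_mx 1 *m B = 0 :> 'rV_p.-1 & C *m B = 1%:M].
Proof.
move=> nab.
have ltS (j : 'I_p.-1) : (j.+1 < p)%N by rewrite -ltn_predRL.
pose S j := Ordinal (ltS j).
exists (\matrix_j (delta_mx 0 (block_point a (S j)) - delta_mx 0 (block_point
  a j0))).
(* Subtracting the copy in block b makes each functional vanish on the all-ones vector without
   affecting its values on block a. *)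
pose B : 'M[F]_(k * p, p.-1) := \matrix_(x, j)
  ((x == block_point a (S j))%:R - (x == block_point b (S j))%:R).
exists B; split.
- apply/row_matrixP=> j; rewrite row_mul rowK mulmxBl -!rowE !row_const.
  by rewrite subrr.
- move=> l la; apply/row_matrixP=> j; rewrite row_mul rowK mulmxBl.
  by rewrite !delta_block_nilp0 1?eq_sym // subrr row0.
- move=> l la lb; apply/row_matrixP=> x; rewrite row_mul row0.
  have [i [j ->]] := block_pointP x.
  have [->|il] := eqVneq i l; last by rewrite row_block_nilp0 // mul0mx.
  have rowB j' : delta_mx 0 (block_point l j') *m B = 0 :> 'rV_p.-1.
    rewrite -rowE; apply/rowP=> j''; rewrite !mxE !eq_block_point.
    by rewrite (negPf la) (negPf lb) subrr.
  by rewrite row_block_nilp; have [j' ->] := Egen_block l j;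
    rewrite mulmxBl !rowB subrr.
- apply/rowP=> j; rewrite !mxE.
  rewrite (eq_bigr (fun x =>
    (x == block_point a (S j))%:R - (x == block_point b (S j))%:R)).
    rewrite sumrB (bigD1 (block_point a (S j))) //= big1 => [|x /negPf->] //.
    rewrite [X in _ - X](bigD1 (block_point b (S j))) //= [X in _ - (_ +
      X)]big1 => [|x /negPf->] //.
    by rewrite !eqxx subrr.
  by move=> x _; rewrite !mxE mul1r.
apply/row_matrixP=> j; rewrite row_mul rowK mulmxBl -!rowE row1.
apply/rowP=> l; rewrite !mxE !eq_block_point !eqxx (negPf nab) /= subr0 subr0.
by rewrite -!val_eqE /= eqSS subr0 eq_sym.
Qed.

End BlockMatrices.

(** * Coordinates on D(1) *)

Local Notation natural_dim F n :=
  (\rank <<in_factmod (all_ones F n) (sum_zero F n)>>%MS).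

Section SectionCoordinates.

Variables (F : fieldType) (n : nat).
Hypothesis nF0 : n%:R = 0 :> F.

Let U : 'M[F]_n := all_ones F n.
Let V : 'M[F]_n := sum_zero F n.
Let W := <<in_factmod U V>>%MS.
Let one : 'cV[F]_n := const_mx 1.
Let sg : 'rV[F]_n := const_mx 1.

Definition to_natural : 'M[F]_(n, natural_dim F n) :=
  in_submod W (in_factmod U 1%:M).
Definition of_natural : 'M[F]_(natural_dim F n, n) :=
  val_factmod (val_submod (1%:M : 'M_(\rank W))).

Let to_naturalE m (v : 'M_(m, n)) :
  v *m to_natural = in_submod W (in_factmod U v).
Proof.
rewrite /to_natural in_submodE [RHS]in_submodE mulmxA; congr (_ *m _).
by rewrite [RHS]in_factmodE.
Qed.

Let of_naturalE m (v : 'M_(m, natural_dim F n)) :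
  v *m of_natural = val_factmod (val_submod (v : 'M_(m, \rank W))).
Proof.
rewrite /of_natural val_factmodE [RHS]val_factmodE mulmxA; congr (_ *m _).
by rewrite [RHS]val_submodE.
Qed.

Lemma of_naturalK : of_natural *m to_natural = 1%:M.
Proof. by rewrite to_naturalE /of_natural val_factmodK val_submodK. Qed.

Let sub_sum_zero m (v : 'M_(m, n)) : v *m one = 0 -> (v <= V)%MS.
Proof. by move=> v0; apply/sub_kermxP. Qed.

Let sg_sum_zero : (sg <= V)%MS.
Proof.
apply/sum_zeroP; rewrite (eq_bigr (fun=> 1)) => [|i _]; last by rewrite mxE.
by rewrite sumr_const card_ord.
Qed.

Let UV : (U <= V)%MS.
Proof. by rewrite genmxE. Qed.

Lemma of_natural_one : of_natural *m one = 0.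
Proof.
apply/sub_kermxP; rewrite -/V.
have sub1 : (val_submod (1%:M : 'M_(\rank W)) <= in_factmod U V)%MS.
  by rewrite val_submod1 genmxE.
have /submxP[x xE] := sub1.
rewrite /of_natural xE val_factmodE -mulmxA -val_factmodE.
apply: submx_trans (submxMl _ _) _; apply: submx_trans (proj_factmodS _ _) _.
by rewrite addsmx_sub UV submx_refl.
Qed.

Lemma to_natural_const : sg *m to_natural = 0.
Proof.
rewrite to_naturalE (_ : in_factmod U sg = 0); first by rewrite linear0.
by apply/eqP; rewrite in_factmod_eq0 genmxE.
Qed.

Lemma to_naturalK m (v : 'M_(m, n)) : v *m one = 0 ->
  exists c : 'cV_m, v *m to_natural *m of_natural = v + c *m sg.
Proof.
move=> /sub_sum_zero vV.
have vW : (in_factmod U v <= W)%MS.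
  by rewrite genmxE; apply: submxMr.
have : (v *m to_natural *m of_natural - v <= U)%MS.
  rewrite -in_factmod_eq0 linearB /= of_naturalE to_naturalE in_submodK //.
  by rewrite val_factmodK subrr.
rewrite (genmxE sg) => /submxP[c cE]; exists c.
by rewrite -cE addrC subrK.
Qed.

Lemma natural_dim_le : (0 < n)%N -> (natural_dim F n + 2 <= n)%N.
Proof.
move=> n_gt0; have rkV : (\rank V + 1 <= n)%N.
  rewrite /V /sum_zero mxrank_ker -[X in (_ <= X)%N](subnK n_gt0) leq_add2r.
  apply: leq_sub2l; rewrite lt0n mxrank_eq0;
    apply/eqP => /matrixP/(_ (Ordinal n_gt0) 0).
  by rewrite !mxE => /eqP; rewrite oner_eq0.
have rkU : (0 < \rank U)%N.
  rewrite genmxE lt0n mxrank_eq0; apply/eqP => /matrixP/(_ 0 (Ordinal n_gt0)).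
  by rewrite !mxE => /eqP; rewrite oner_eq0.
have := mxrank_in_factmod U V; rewrite (addsmx_idPr UV) => rkW.
rewrite genmxE; apply: leq_trans rkV; rewrite -rkW.
by rewrite -[2%N]/(1 + 1)%N addnA !leq_add2r leq_add2l.
Qed.

Lemma to_natural_repr (x : 'S_n) m (v : 'M_(m, n)) : v *m one = 0 ->
  v *m perm_mx x *m to_natural = v *m to_natural *m natural_simple_repr F n x.
Proof.
move=> /sub_sum_zero vV.
have vW : (in_factmod U v <= W)%MS by rewrite genmxE; apply: submxMr.
rewrite !to_naturalE /natural_simple_repr /section_repr.
rewrite -[perm_mx x]/(perm_repr F n x).
rewrite (in_factmodJ (all_ones_module F n)) ?inE //.
by rewrite -in_submodJ ?inE.
Qed.

End SectionCoordinates.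

(** * Shifted units acting on modules, and the rank variety *)

Lemma gring_op_shifted_unit (F : fieldType) (gT : finGroupType) (E : {group gT})
    k (g : 'I_k -> gT) (alpha : {ffun 'I_k -> F}) n (rM : mx_representation F
      E n) :
    (forall i, g i \in E) ->
  gring_op rM (shifted_unit E g alpha) =
  1%:M + \sum_i alpha i *: (rM (g i) - 1%:M).
Proof.
move=> Eg; rewrite linearD /= gring_op1 linear_sum; congr (_ + _).
apply: eq_bigr => i _; rewrite linearZ /= linearB /= gring_op1 gring_opG //.
Qed.

Lemma gring_op_expr (F : fieldType) (gT : finGroupType) (E : {group gT})
    k (g : 'I_k -> gT) (alpha : {ffun 'I_k -> F}) n (rM : mx_representation F
      E n) i :
    (forall i, g i \in E) ->
  gring_op rM (shifted_unit E g alpha ^+ i) =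
  gring_op rM (shifted_unit E g alpha) ^+ i.
Proof.
move=> Eg; elim: i => [|i IH]; first by rewrite !expr0 gring_op1.
rewrite !exprSr -!mulmxE gring_opM ?IH //.
rewrite /shifted_unit linearD /=
  addmx_sub ?envelop_mx1 // linear_sum summx_sub // => l _.
rewrite linearZ scalemx_sub // linearB /= addmx_sub ?eqmx_opp ?envelop_mx1 //.
exact: envelop_mx_id.
Qed.

Theorem theorem5p3 (F : closedFieldType) (p k : nat) :
  p \in [pchar F] -> (3 <= p)%N -> (2 <= k)%N -> k <> 1 %[mod p] ->
  forall alpha : {ffun 'I_k -> F},
    rank_variety p (@Egen k p)
      (subg_repr (D_repr F (k * p) p.-1) (subsetT (Egroup k p))) alpha
    <-> zero_set (p_poly F k p) alpha.
Proof.
move=> pcharF _ k_ge2 _ alpha.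
have p_pr := pcharf_prime pcharF; have p_gt0 := prime_gt0 p_pr.
have k_gt0 : (0 < k)%N := ltnW k_ge2.
have nF0 : (k * p)%N%:R = 0 :> F by rewrite natrM (pcharf0 pcharF) mulr0.
pose rM := subg_repr (D_repr F (k * p) p.-1) (subsetT (Egroup k p)).
pose Xd (i : 'I_k) := natural_simple_repr F (k * p) (Egen p i) - 1%:M.
have Eg i : Egen p i \in Egroup k p by rewrite mem_gen // imset_f.
have dim_d : (natural_dim F (k * p)%N < k.-1 * p + p.-1)%N.
  have := natural_dim_le nF0; rewrite muln_gt0 k_gt0 p_gt0 => /(_ isT).
  have kpE : (k * p = k.-1 * p + p)%N by rewrite -mulSnr prednK.
  rewrite [X in (_ <= X)%N]kpE => le.
  by rewrite -ltnS -addnS prednK // -addn2.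
have f_X i m (v : 'M_(m, k * p)) : v *m const_mx 1 = 0 :> 'cV_m ->
    v *m block_nilp F p i *m to_natural F (k * p) = v *m to_natural F (k * p)
      *m Xd i.
  by move=> v0; rewrite !mulmxBr mulmxBl !mulmx1 to_natural_repr.
have zeroE : zero_set (p_poly F k p) alpha <-> gram_poly p alpha = 0.
  suffices -> : gram_poly p alpha = (p_poly F k p).@[alpha] by [].
  rewrite /p_poly raddf_sum /=; apply: eq_bigr => i _.
  rewrite rmorphXn rmorph_prod -prodrXl; apply: eq_bigr => j _.
  by rewrite /= mevalXU.
have modelP := model_exactP pcharF
   (@block_nilp_orth F p k) (block_nilp_exp pcharF) (@block_nilp_one F p k)
   (block_origin_nilp pcharF) (block_origin_one k pcharF) (block_origin_top k
     pcharF)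
   (block_origin_dual k pcharF)
   f_X (of_naturalK F (k * p)) (of_natural_one nF0) (@to_naturalK F (k * p))
     (to_natural_const F (k * p))
   (@two_block_frames F p k pcharF) k_gt0 dim_d alpha.
set t := (X in p_exact p X) in modelP.
have tp0 : t ^+ p = 0.
  apply: ext_shift_exp => // [i j|i].
    exact: (model_comm (@block_nilp_orth F p k) (@block_nilp_one F p k) f_X
             (of_naturalK F (k * p)) (of_natural_one nF0)).
  exact: (model_exp (block_nilp_exp pcharF) (@block_nilp_one F p k) f_X
             (of_naturalK F (k * p)) (of_natural_one nF0)).
have uE : gring_op rM (shifted_unit (Egroup k p) (@Egen k p) alpha) = 1 + t.
  have rME i : rM (Egen p i) = ext_mx p.-1 (1%:M + Xd i).
    by rewrite [1%:M + _]addrC subrK.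
  rewrite (gring_op_shifted_unit alpha rM Eg); congr (_ + _).
  apply: eq_bigr => i _.
  by rewrite rME.
have freeP : free_over_cyclic p (shifted_unit (Egroup k p) (@Egen k p) alpha)
  rM <->
    p_exact p t.
  have combE m (c : 'M[F]_(m, p)) j :
      gring_op rM (\sum_(i < p) c j i *: shifted_unit (Egroup k p) (@Egen k p)
        alpha ^+ i) =
      \sum_(i < p) c j i *: (1 + t) ^+ i.
    rewrite linear_sum; apply: eq_bigr => i _.
    by rewrite linearZ /= gring_op_expr // uE.
  rewrite -(free_exactP p_gt0 tp0); split=> -[m [b free]]; exists m, b => v.
    have [c [vE uc]] := free v; exists c; split.
      by rewrite vE; apply: eq_bigr => j _; rewrite combE.
    by move=> c' vE'; apply: uc; rewrite vE'; apply: eq_bigr => j _;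
      rewrite combE.
  have [c [vE uc]] := free v; exists c; split.
    by rewrite vE; apply: eq_bigr => j _; rewrite combE.
  by move=> c' vE'; apply: uc; rewrite vE'; apply: eq_bigr => j _;
    rewrite combE.
(* The origin belongs to the rank variety by definition; since k >= 2, every product in p_k keeps a
   factor and vanishes there. *)
have gram0 : alpha = 0 -> gram_poly p alpha = 0.
  move=> ->; rewrite /gram_poly big1 // => i _.
  have [j nji] : exists j, j != i.
    have lt0 : (0 < k)%N := k_gt0.
    have [e|ne] := eqVneq i (Ordinal lt0); last by exists (Ordinal lt0);
      rewrite eq_sym.
    by exists (Ordinal k_ge2); rewrite e.
  by rewrite (bigD1 j) //= ffunE expr0n gtn_eqF ?mul0r // ltn_predRL prime_gt1.
rewrite zeroE /rank_variety freeP modelP; split.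
  by case=> [/gram0|[_ /negP]]; rewrite ?negbK => // /eqP.
move=> g0; have [->|nz] := eqVneq alpha 0; first by left.
by right; split=> //; rewrite g0 eqxx.
Qed.
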